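(* Let $G$ be a countable sofic group acting by measure-preserving transformations on a standard probability space $(X,\mu)$, and let $\Sigma=\{\sigma_i:G\to\mathrm{Sym}(d_i)\}_{i=1}^\infty$ be a sofic approximation sequence for $G$. Let $\mathcal S=\{p_n\}_{n=1}^\infty$ and $\mathcal T=\{q_n\}_{n=1}^\infty$ be dynamically generating sequences in the unit ball of $L^\infty_{\mathbb R}(X,\mu)$. Then $h_{\Sigma,\mu}(\mathcal T)=h_{\Sigma,\mu}(\mathcal S)$.
   Context: **Sofic approximations.** $\mathrm{Sym}(d)$ is the permutation group of $\{1,\dots,d\}$. A sofic approximation sequence for a countable discrete group $G$ (identity $e$) is a sequence of maps (not necessarily homomorphisms) $\sigma_i:G\to\mathrm{Sym}(d_i)$, $s\mapsto\sigma_{i,s}$, with $\lim_i d_i=\infty$, $\lim_i \frac1{d_i}|\{k:\sigma_{i,st}(k)=\sigma_{i,s}\sigma_{i,t}(k)\}|=1$ for all $s,t\in G$, and $\lim_i\frac1{d_i}|\{k:\sigma_{i,s}(k)\ne\sigma_{i,t}(k)\}|=1$ for all distinct $s,t\in G$. $G$ is sofic if maps with the last two properties exist. For a map $\sigma:G\to\mathrm{Sym}(d)$, $s\in G$ and $f\in\mathbb C^d\cong C(\{1,\dots,d\})$ put $\sigma_s(f)=f\circ\sigma_s^{-1}$. $\zeta$ is the uniform probability measure on $\{1,\dots,d\}$, also viewed as the functional $\zeta(f)=\frac1d\sum_k f(k)$; on $\mathbb C^d$, $\|f\|_2=(\frac1d\sum_k|f(k)|^2)^{1/2}$. For a pseudometric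 space $(Y,\rho)$ and $\varepsilon\ge0$, $N_\varepsilon(Y,\rho)$ is the maximal cardinality of a finite $\varepsilon$-separated subset of $Y$ (pairwise distances $>\varepsilon$). Convention: $\log 0=-\infty$. **Measure setting.** For $f\in L^\infty(X,\mu)$, $\alpha_s(f)(x)=f(s^{-1}x)$. $\mu(f)=\int f\,d\mu$. The unit ball is with respect to the $L^\infty$-norm, and $L^\infty_{\mathbb R}$ denotes the real-valued functions. A subset of $L^\infty(X,\mu)$ (or a sequence, via its image) is dynamically generating if it is not contained in any proper $G$-invariant von Neumann subalgebra of $L^\infty(X,\mu)$. A linear map is unital if it sends $1$ to $1$ and positive if it sends nonnegative functions to nonnegative functions. **Entropy of a sequence.** Let $\mathcal S=\{p_n\}_{n\in\mathbb N}$ be a sequence in the unit ball of $L^\infty_{\mathbb R}(X,\mu)$. For nonempty finite $F\subseteq G$ and $m\in\mathbb N$, $\mathcal S_{F,m}$ is the set of all products $\alpha_{s_1}(f_1)\cdots\alpha_{s_j}(f_j)$ with $1\le j\le m$, $f_1,\dots,f_j\in\{p_1,\dots,p_m\}$, $s_1,\dots,s_j\in F$. Put $\rho_{\mathcal S}(\varphi,\psi)=\sum_{n=1}^\infty 2^{-n}\|\varphi(p_n)-\psi(p_n)\|_2$. For $\delta>0$ and $\sigma:G\to\mathrm{Sym}(d)$, $\mathrm{UP}_\mu(\mathcal S,F,m,\delta,\sigma)$ is the set of unital positive linear maps $\varphi:L^\infty(X,\mu)\to\mathbb C^d$ such that (i) $\|\varphi(\alpha_{s_1}(f_1)\cdots\alpha_{s_j}(f_j))-\varphi(\alpha_{s_1}(f_1))\cdots\varphi(\alpha_{s_j}(f_j))\|_2<\delta$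 for all $1\le j\le m$, $f_1,\dots,f_j\in\{p_1,\dots,p_m\}$, $s_1,\dots,s_j\in F$; (ii) $|\zeta\circ\varphi(f)-\mu(f)|<\delta$ for all $f\in\mathcal S_{F,m}$; (iii) $\|\varphi\circ\alpha_s(f)-\sigma_s\circ\varphi(f)\|_2<\delta$ for all $s\in F$, $f\in\{p_1,\dots,p_m\}$. Define $h^\varepsilon_{\Sigma,\mu}(\mathcal S,F,m,\delta)=\limsup_{i\to\infty}\frac1{d_i}\log N_\varepsilon(\mathrm{UP}_\mu(\mathcal S,F,m,\delta,\sigma_i),\rho_{\mathcal S})$, and $h_{\Sigma,\mu}(\mathcal S)=\sup_{\varepsilon>0}\inf_F\inf_{m\in\mathbb N}\inf_{\delta>0}h^\varepsilon_{\Sigma,\mu}(\mathcal S,F,m,\delta)$, where $F$ ranges over nonempty finite subsets of $G$. *)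

(* Defs.v *)
From HB Require Import structures.
From mathcomp Require Import all_boot all_order all_algebra perm.
From mathcomp Require Import all_classical all_reals all_analysis.
From mathcomp Require Import ess_sup_inf measurable_realfun.
From mathcomp.real_closed Require Import complex.

Set Implicit Arguments.
Unset Strict Implicit.
Unset Printing Implicit Defensive.

Import Order.TTheory GRing.Theory Num.Theory.
Import numFieldNormedType.Exports.
Import ComplexField ComplexField.Normc.

Local Open Scope classical_set_scope.
Local Open Scope ring_scope.
Local Open Scope complex_scope.

(* The separable Hausdorff complete pseudometric spaces are the Polish spaces. *)
Definition standard_borel (R : realType) (disp : measure_display)
    (X : measurableType disp) : Prop :=
  exists (T : completePseudoMetricType R) (f : X -> T),
    [/\ hausdorff_space T,
        (exists2 D : set T, countable D & dense D),
        bijective f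
      & forall A : set X, measurable A <-> <<s open >> (f @` A)].

Record pmp_action (G : groupType) (disp : measure_display)
    (X : measurableType disp) (R : realType) (mu : probability X R) := PmpAction {
  act :> G -> X -> X;
  act1 : forall x, act 1%g x = x;
  actM : forall s t x, act (s * t)%g x = act s (act t x);
  measurable_act : forall s, measurable_fun [set: X] (act s);
  act_preserving : forall s (A : set X), measurable A ->
    mu (act s @^-1` A) = mu A
}.

(* [Linfty mu] consists of the representatives of the classes of the complex
   space [L^oo(X, mu)]; two of them stand for the same element when they agree
   almost everywhere.  Maps out of [L^oo] are maps on representatives that
   respect this (see [up_ae]), and weak-* closed sets of representatives are
   stable under it. *)

Section Linfty.
Context (disp : measure_display) (X : measurableType disp) (R : realType).
Variable mu : probability X R.

Definition cmeasurable (f : X -> R[i]) : Prop :=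
  measurable_fun [set: X] (fun x => complex.Re (f x)) /\
  measurable_fun [set: X] (fun x => complex.Im (f x)).

Definition Linfty_norm (f : X -> R[i]) : \bar R :=
  Lnorm mu +oo (fun x => (normc (f x))%:E).

Definition Linfty_pred : {pred X -> R[i]} :=
  mem [set f : X -> R[i] | cmeasurable f /\ (Linfty_norm f < +oo)%E].

Record Linfty := MkLinfty {
  Linfty_fun :> X -> R[i];
  Linfty_funP : Linfty_fun \in Linfty_pred
}.

HB.instance Definition _ := [isSub for Linfty_fun].
HB.instance Definition _ := [Choice of Linfty by <:].

Lemma Linfty_normE f :
  Linfty_norm f = ess_sup mu (fun x => (normc (f x))%:E).
Proof.
have mu0 : (0 < mu [set: X])%E by rewrite probability_setT lte01.
rewrite /Linfty_norm unlock mu0.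
congr ess_sup; apply/funext => x /=.
by rewrite ger0_norm//; case: (f x) => a b /=; exact: sqrtr_ge0.
Qed.

Lemma Linfty_norm_ltP f : (Linfty_norm f < +oo)%E <->
  exists M : R, \forall x \ae mu, normc (f x) <= M.
Proof.
rewrite Linfty_normE; split=> [/ess_supr_bounded //|[M fM]].
by apply: (@le_lt_trans _ _ M%:E); rewrite ?ltry//; exact/ess_supP.
Qed.

Lemma Linfty_predP f : reflect
  (cmeasurable f /\ exists M : R, \forall x \ae mu, normc (f x) <= M)
  (f \in Linfty_pred).
Proof.
by apply: (iffP idP) => [/set_mem[mf /Linfty_norm_ltP]|[mf /Linfty_norm_ltP nf]];
  [|apply/mem_set].
Qed.

Lemma cmeasurable_cst c : cmeasurable (cst c).
Proof. by split; exact: measurable_cst. Qed.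

Lemma cmeasurableB f g : cmeasurable f -> cmeasurable g -> cmeasurable (f - g).
Proof.
move=> [f1 f2] [g1 g2]; split.
- rewrite (_ : (fun _ => _) = (fun x => complex.Re (f x)) \- (fun x => complex.Re (g x))).
    exact: measurable_funB.
  by apply/funext => x; rewrite /= !fctE; case: (f x) (g x) => a b [].
- rewrite (_ : (fun _ => _) = (fun x => complex.Im (f x)) \- (fun x => complex.Im (g x))).
    exact: measurable_funB.
  by apply/funext => x; rewrite /= !fctE; case: (f x) (g x) => a b [].
Qed.

Lemma cmeasurableM f g : cmeasurable f -> cmeasurable g -> cmeasurable (f * g).
Proof.
move=> [f1 f2] [g1 g2]; split.
- rewrite (_ : (fun _ => _) =
      ((fun x => complex.Re (f x)) \* (fun x => complex.Re (g x))) \-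
      ((fun x => complex.Im (f x)) \* (fun x => complex.Im (g x)))).
    by apply: measurable_funB; exact: measurable_funM.
  by apply/funext => x; rewrite /= !fctE; case: (f x) (g x) => a b [].
- rewrite (_ : (fun _ => _) =
      ((fun x => complex.Re (f x)) \* (fun x => complex.Im (g x))) \+
      ((fun x => complex.Im (f x)) \* (fun x => complex.Re (g x)))).
    by apply: measurable_funD; exact: measurable_funM.
  by apply/funext => x; rewrite /= !fctE; case: (f x) (g x) => a b [].
Qed.

Lemma Linfty_cst c : cst c \in Linfty_pred.
Proof.
apply/Linfty_predP; split; first exact: cmeasurable_cst.
by exists (normc c); apply: nearW => x.
Qed.

Lemma Linfty_mulr2_closed : {in Linfty_pred &, forall f g, f * g \in Linfty_pred}.
Proof.
move=> f g /Linfty_predP[mf [M fM]] /Linfty_predP[mg [N gN]].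
apply/Linfty_predP; split; first exact: cmeasurableM.
exists (M * N); move: fM gN; apply: filterS2 => x fM gN.
rewrite fctE normcM ler_pM//; [case: (f x)|case: (g x)] => a b;
  exact: sqrtr_ge0.
Qed.

Lemma Linfty_subring_closed : subring_closed Linfty_pred.
Proof.
split; [exact: Linfty_cst| |exact: Linfty_mulr2_closed].
move=> f g /Linfty_predP[mf [M fM]] /Linfty_predP[mg [N gN]].
apply/Linfty_predP; split; first exact: cmeasurableB.
exists (M + N); move: fM gN; apply: filterS2 => x fM gN.
rewrite fctE (le_trans (le_normcD (f x) (- g x)))// lerD//.
by rewrite (normcN (g x)).
Qed.

Lemma Linfty_scaler_closed : scaler_closed Linfty_pred.
Proof.
by move=> a f fL; rewrite -[a *: f]/(cst a * f) Linfty_mulr2_closed ?Linfty_cst.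
Qed.

HB.instance Definition _ :=
  GRing.isSubringClosed.Build (X -> R[i]) Linfty_pred Linfty_subring_closed.
HB.instance Definition _ :=
  GRing.isScaleClosed.Build R[i] (X -> R[i]) Linfty_pred Linfty_scaler_closed.

HB.instance Definition _ :=
  GRing.SubChoice_isSubComPzRing.Build _ _ Linfty Linfty_subring_closed.
HB.instance Definition _ := [SubZmodule_isSubLmodule of Linfty by <:].

Lemma Linfty_conj_subproof (f : Linfty) : (fun x => conjc (f x)) \in Linfty_pred.
Proof.
have /Linfty_predP[[f1 f2] [M fM]] := Linfty_funP f.
apply/Linfty_predP; split; last first.
  exists M; move: fM; apply: filterS => x.
  by case: (f x) => a b /=; rewrite sqrrN.
split.
- rewrite (_ : (fun _ => _) = (fun x => complex.Re (f x)))//.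
  by apply/funext => x; case: (f x).
- rewrite (_ : (fun _ => _) = \- (fun x => complex.Im (f x))).
    exact: measurableT_comp.
  by apply/funext => x /=; case: (f x).
Qed.

Definition Linfty_conj (f : Linfty) : Linfty := MkLinfty (Linfty_conj_subproof f).

Definition real_unit_ball : set Linfty :=
  [set f | (\forall x \ae mu, f x \is Num.real) /\ (Linfty_norm f <= 1)%E].

Definition cintegral (f : X -> R[i]) : R[i] :=
  (\int[mu]_(x in [set: X]) complex.Re (f x)) +i*
  (\int[mu]_(x in [set: X]) complex.Im (f x)).

Definition cintegrable (f : X -> R[i]) : Prop :=
  mu.-integrable [set: X] (fun x => (complex.Re (f x))%:E) /\
  mu.-integrable [set: X] (fun x => (complex.Im (f x))%:E).

(* Closed in the weak-* topology [sigma(L^oo, L^1)], whose basic neighbourhoods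
   of [f] are given by finitely many [g_i] in [L^1].  As the [L^1] functions are
   the products of two [L^2] functions, it is also the weak operator topology
   of [L^oo] acting on [L^2] by multiplication. *)
Definition weakstar_closed (N : set Linfty) : Prop :=
  forall f : Linfty,
    (forall (k : nat) (g : 'I_k -> X -> R[i]) (e : R),
      (forall i, cintegrable (g i)) -> 0 < e ->
      exists2 h : Linfty, N h &
        forall i, normc (cintegral (fun x => (f x - h x) * g i x)) < e) ->
    N f.

Record von_neumann_subalgebra (N : set Linfty) : Prop := {
  vN1 : N 1;
  vND : forall f g, N f -> N g -> N (f + g);
  vNZ : forall (c : R[i]) f, N f -> N (c *: f);
  vNM : forall f g, N f -> N g -> N (f * g);
  vN_conj : forall f, N f -> N (Linfty_conj f);
  vN_closed : weakstar_closed N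
}.

Record unital_positive (d : nat) (phi : Linfty -> 'I_d -> R[i]) : Prop := {
  up_ae : forall f g : Linfty, (\forall x \ae mu, f x = g x) -> phi f = phi g;
  up_linear : linear phi;
  up_unital : phi 1 = 1;
  up_positive : forall f : Linfty, (\forall x \ae mu, 0 <= f x) ->
    forall k, 0 <= phi f k
}.

End Linfty.

Section Koopman.
Context (G : groupType) (disp : measure_display) (X : measurableType disp)
  (R : realType) (mu : probability X R) (a : pmp_action G mu).

Lemma ae_act (s : G) (P : X -> Prop) :
  (\forall x \ae mu, P x) -> \forall x \ae mu, P (a s x).
Proof.
move=> [A [mA A0 PA]]; exists (a s @^-1` A); split.
- by rewrite -[_ @^-1` _]setTI; exact: measurable_act.
- by rewrite act_preserving.
- by move=> x; exact: PA.
Qed.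

Lemma koopman_subproof (s : G) (f : Linfty mu) :
  (fun x => f (a s^-1%g x)) \in Linfty_pred mu.
Proof.
have /Linfty_predP[[f1 f2] [M fM]] := Linfty_funP f.
apply/Linfty_predP; split; last by exists M; exact: (ae_act s^-1%g fM).
by split; [exact: (measurableT_comp f1 (measurable_act a _))
          |exact: (measurableT_comp f2 (measurable_act a _))].
Qed.

Definition koopman (s : G) (f : Linfty mu) : Linfty mu :=
  MkLinfty (koopman_subproof s f).

Definition dynamically_generating (p : nat -> Linfty mu) : Prop :=
  forall N : set (Linfty mu), von_neumann_subalgebra N ->
    (forall s, koopman s @` N `<=` N) ->
    (forall n, N (p n)) -> N = [set: Linfty mu].

End Koopman.

Section Cd.
Context (R : realType) (d : nat).

Definition norm2 (f : 'I_d -> R[i]) : R :=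
  Num.sqrt (d%:R^-1 * \sum_(k < d) normc (f k) ^+ 2).

Definition zeta (f : 'I_d -> R[i]) : R[i] := d%:R^-1 * \sum_(k < d) f k.

Definition perm_shift (u : 'S_d) (f : 'I_d -> R[i]) : 'I_d -> R[i] :=
  fun k => f (u^-1%g k).

End Cd.

Definition sep_number (R : realType) (T : Type) (Y : set T)
    (rho : T -> T -> \bar R) (e : R) : \bar R :=
  ereal_sup [set (n%:R)%:E | n in [set n : nat |
    exists A : set T, [/\ A `<=` Y, (A #= `I_n)%card
      & forall x y, A x -> A y -> x <> y -> (e%:E < rho x y)%E]]].

Section Sofic.
Context (R : realType) (G : groupType).

(* The product of permutations in ['S_d] is in diagrammatic order, so the
   composition [sigma_s sigma_t] is spelled out. *)
Definition sofic_maps (d : nat -> nat) (sigma : forall i, G -> 'S_(d i)) : Prop :=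
  (forall s t : G,
    #|[pred k | sigma i (s * t)%g k == sigma i s (sigma i t k)]|%:R / (d i)%:R
      @[i --> \oo] --> (1 : R)) /\
  (forall s t : G, s <> t ->
    #|[pred k | sigma i s k != sigma i t k]|%:R / (d i)%:R
      @[i --> \oo] --> (1 : R)).

Definition sofic : Prop :=
  exists (d : nat -> nat) (sigma : forall i, G -> 'S_(d i)), sofic_maps sigma.

Definition sofic_approximation (d : nat -> nat)
    (sigma : forall i, G -> 'S_(d i)) : Prop :=
  d @ \oo --> \oo /\ sofic_maps sigma.

End Sofic.

(* The sequence [p_1, p_2, ...] is indexed from [0], so [p_1, ..., p_m] are the
   [p n] with [n < m], and [p n] has weight [2 ^- n.+1] in [rho]. *)

Section Entropy.
Context (G : groupType) (disp : measure_display) (X : measurableType disp)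
  (R : realType) (mu : probability X R) (a : pmp_action G mu).
Variable p : nat -> Linfty mu.

Definition admissible (F : set G) (m j : nat) (s : 'I_j -> G) (n : 'I_j -> nat) :
    Prop :=
  [/\ (1 <= j <= m)%N, forall l, F (s l) & forall l, (n l < m)%N].

Definition word (j : nat) (s : 'I_j -> G) (n : 'I_j -> nat) : Linfty mu :=
  \prod_(l < j) koopman a (s l) (p (n l)).

Definition words (F : set G) (m : nat) : set (Linfty mu) :=
  [set f | exists j (s : 'I_j -> G) (n : 'I_j -> nat),
    admissible F m s n /\ f = word s n].

Definition rho (d : nat) (phi psi : Linfty mu -> 'I_d -> R[i]) : \bar R :=
  (\sum_(0 <= n <oo) ((2^-1 ^+ n.+1) * norm2 (phi (p n) - psi (p n)))%:E)%E.

Definition UP (F : set G) (m : nat) (delta : R) (d : nat) (sigma : G -> 'S_d) :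
    set (Linfty mu -> 'I_d -> R[i]) :=
  [set phi | [/\ unital_positive phi,
    forall j (s : 'I_j -> G) (n : 'I_j -> nat), admissible F m s n ->
      norm2 (phi (word s n) - \prod_(l < j) phi (koopman a (s l) (p (n l))))
        < delta,
    forall f, words F m f ->
      normc (zeta (phi f) - cintegral mu f) < delta
  & forall s n, F s -> (n < m)%N ->
      norm2 (phi (koopman a s (p n)) - perm_shift (sigma s) (phi (p n)))
        < delta]].

Variables (d : nat -> nat) (sigma : forall i, G -> 'S_(d i)).

Definition entropy_at (e : R) (F : set G) (m : nat) (delta : R) : \bar R :=
  limn_esup (fun i => ((d i)%:R^-1)%:E *
    lne (sep_number (UP F m delta (sigma i)) (@rho (d i)) e))%E.

Definition entropy : \bar R :=
  ereal_sup [set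
    ereal_inf [set
      ereal_inf [set
        ereal_inf [set entropy_at e F m delta | delta in [set delta : R | 0 < delta]]
      | m in [set m : nat | (0 < m)%N]]
    | F in [set F : set G | finite_set F /\ F !=set0]]
  | e in [set e : R | 0 < e]].

End Entropy.

(* Main.v *)
(** Let E be the integral and A_p the algebra of polynomials in the translates
    of p.  A finite partition of unity H in A_p gives a unital positive map
    [cexp H f = sum_(h in H) E(f h) / E(h) h] into A_p that preserves E.  Taking
    for H products of Bernoulli partitions [y, 1 - y] built on the generators,
    [cexp H f] converges to [f] in L^2 for [f] in A_p, hence for all [f]: the set of
    such [f] is a G-invariant von Neumann algebra containing p.

    An approximate homomorphism [phi] for p is asymptotically multiplicative,
    equivariant and E-preserving on A_p, and [|phi f|_2^2 <= zeta (phi (f^2))] by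
    positivity.  So [phi \o cexp H] is an approximate homomorphism for q once H is
    fine, although [phi] need not be: what [phi] does to q is not controlled.
    Conversely p is close in L^2 to polynomials in the translates of q, so that
    [phi \o cexp H] on q determines [phi] on p up to a small error.  Thus separated
    sets for p map to separated sets for q of the same cardinality.

    "For F, m, 1/delta, i large" is expressed by filters on the approximate
    homomorphisms ([UPfilter]), and on pairs of them that are close for rho
    ([UPpair_filter]). *)
Require Import Defs.
From HB Require Import structures.
From mathcomp Require Import all_boot all_order all_algebra perm.
From mathcomp Require Import all_classical all_reals all_analysis.
From mathcomp Require Import ess_sup_inf measurable_realfun.
From mathcomp.real_closed Require Import complex.
From mathcomp Require Import ring lra.

Set Implicit Arguments.
Unset Strict Implicit.
Unset Printing Implicit Defensive.

Import Order.TTheory GRing.Theory Num.Theory.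
Import numFieldNormedType.Exports ComplexField.

Local Open Scope classical_set_scope.
Local Open Scope ring_scope.

(** * Probability algebras *)

(** The composite with [phi] must be exactly unital and positive, yet [phi] is controlled only on
    A_p. Indicators of level sets give exact positivity but leave A_p, while polynomial
    approximation stays in A_p but loses positivity; products of [y] and [1 - y] keep both. [cexp H]
    is neither multiplicative nor equivariant. One number, [cvar H f], replaces both properties:
    when it is small for the functions concerned, the two sides of each identity are close in L^2
    inside A_p. The analytic difficulty is weak-* closedness of an L^2-closed class. Bounded
    functions are not complete in L^2, so a best approximation may be missing; a minimizing sequence
    is followed to its L^1 limit, and an L^1 function is exactly what weak-* closedness may be
    tested against. The order of choices matters: the separation scale for q has to precede F, m and
    delta for q, while H comes after them. The scale therefore comes from polynomials in the
    translates of q that approximate p, whose choice does not involve H. *)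

(* The real part of [L^oo(mu)], reduced to what the argument uses: a ring with
   constants [pa_cst], a cone of almost everywhere nonnegative elements, and the
   integral. *)
Record palg (R : realFieldType) := Palg {
  pa_ring :> comPzRingType;
  pa_cst : {rmorphism R -> pa_ring};
  nneg : pa_ring -> Prop;
  Exp : pa_ring -> R;
  nnegD : forall f g, nneg f -> nneg g -> nneg (f + g);
  nnegM : forall f g, nneg f -> nneg g -> nneg (f * g);
  nneg_sqr : forall f, nneg (f ^+ 2);
  nneg_cst : forall c, 0 <= c -> nneg (pa_cst c);
  pa_bounded : forall f, exists2 M, 0 < M &
    nneg (pa_cst M - f) /\ nneg (pa_cst M + f);
  ExpD : forall f g, Exp (f + g) = Exp f + Exp g;
  ExpZ : forall c f, Exp (pa_cst c * f) = c * Exp f;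
  Exp1 : Exp 1 = 1;
  Exp_ge0 : forall f, nneg f -> 0 <= Exp f
}.

Notation "c %:B" := (pa_cst _ c) (at level 1, left associativity, format "c %:B").

Section Palg.
Context (R : realFieldType) (B : palg R).
Implicit Types f g h : B.

Lemma cstBM (a b : R) : (a * b)%:B = a%:B * b%:B :> B. Proof. exact: rmorphM. Qed.
Lemma cstB1 : 1%:B = 1 :> B. Proof. exact: rmorph1. Qed.
Lemma cstB0 : 0%:B = 0 :> B. Proof. exact: rmorph0. Qed.

Lemma nneg0 : nneg (0 : B). Proof. by rewrite -cstB0; exact: nneg_cst. Qed.
Lemma nneg1 : nneg (1 : B). Proof. by rewrite -cstB1; exact: nneg_cst. Qed.
Lemma nneg_sum (I : eqType) (r : seq I) (F : I -> B) :
  (forall i, i \in r -> nneg (F i)) -> nneg (\sum_(i <- r) F i).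
Proof.
move=> F0; rewrite big_seq; elim/big_ind: _ => //; [exact: nneg0|exact: nnegD].
Qed.

Definition unitball f := nneg (1 - f) /\ nneg (1 + f).

Lemma ExpN f : Exp (- f) = - Exp f.
Proof. by rewrite -mulN1r -cstB1 -rmorphN ExpZ mulN1r. Qed.

Lemma ExpB f g : Exp (f - g) = Exp f - Exp g.
Proof. by rewrite ExpD ExpN. Qed.

Lemma Exp0 : Exp (0 : B) = 0.
Proof. by rewrite -(mul0r 0) -cstB0 ExpZ mul0r. Qed.

Lemma Exp_sum I (r : seq I) (F : I -> B) :
  Exp (\sum_(i <- r) F i) = \sum_(i <- r) Exp (F i).
Proof. by elim/big_rec2: _ => [|i y z _ <-]; rewrite ?Exp0 ?ExpD. Qed.

Lemma Exp_le f g : nneg (g - f) -> Exp f <= Exp g.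
Proof. by move=> /Exp_ge0; rewrite ExpB subr_ge0. Qed.

Lemma Exp_mul0 f h : nneg h -> Exp h = 0 -> Exp (f * h) = 0.
Proof.
move=> h0 Eh; have [M M0 [f1 f2]] := pa_bounded f.
have := Exp_ge0 (nnegM f1 h0); have := Exp_ge0 (nnegM f2 h0).
rewrite mulrBl mulrDl ExpB ExpD !ExpZ Eh mulr0 add0r sub0r oppr_ge0 => u v.
by apply/eqP; rewrite eq_le u v.
Qed.

Lemma Exp_sqrD f g : Exp ((f + g) ^+ 2) <= 2 * Exp (f ^+ 2) + 2 * Exp (g ^+ 2).
Proof.
rewrite -!ExpZ -ExpD; apply: Exp_le.
by rewrite (_ : _ - _ = (f - g) ^+ 2); [exact: nneg_sqr|ring].
Qed.

(** The triangle inequality in squared form. Working with squares replaces every norm estimate by a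
    polynomial identity in the cone, at the cost of a factor 2 per use. *)
Lemma Exp_sqr_tri g f h :
  Exp ((f - h) ^+ 2) <= 2 * Exp ((f - g) ^+ 2) + 2 * Exp ((g - h) ^+ 2).
Proof. by rewrite -(subrKA g) Exp_sqrD. Qed.

Lemma Exp_sqrBC f g : Exp ((f - g) ^+ 2) = Exp ((g - f) ^+ 2).
Proof. by congr Exp; ring. Qed.

Lemma Exp_sqrM f g : unitball g -> Exp ((f * g) ^+ 2) <= Exp (f ^+ 2).
Proof.
move=> [g1 g2]; apply: Exp_le.
rewrite (_ : _ - _ = f ^+ 2 * ((1 - g) * (1 + g))); last by ring.
by apply: nnegM; [exact: nneg_sqr|exact: nnegM].
Qed.

End Palg.

(** * Conditional means along partitions of unity *)

Section Partitions.
Context (R : realType) (B : palg R).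
Implicit Types (f g h : B) (H : seq B).

Lemma ler_sum_seq (I : eqType) (r : seq I) (F G : I -> R) :
  (forall i, i \in r -> F i <= G i) -> \sum_(i <- r) F i <= \sum_(i <- r) G i.
Proof. by move=> FG; rewrite big_seq [leRHS]big_seq; exact: ler_sum. Qed.

Lemma ler_sum_seq2 (I : eqType) (r : seq I) (F G K : I -> R) a b :
  (forall i, i \in r -> K i <= a * F i + b * G i) ->
  \sum_(i <- r) K i <= a * (\sum_(i <- r) F i) + b * \sum_(i <- r) G i.
Proof. by move=> FG; rewrite !mulr_sumr -big_split; exact: ler_sum_seq. Qed.

Record subalgebra (A : B -> Prop) : Prop := {
  sa1 : A 1;
  saD : forall f g, A f -> A g -> A (f + g);
  saM : forall f g, A f -> A g -> A (f * g);
  saK : forall c, A c%:B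
}.

Lemma saZ A c f : subalgebra A -> A f -> A (c%:B * f).
Proof. by move=> sA Af; apply: saM => //; exact: saK. Qed.

Lemma saB A f g : subalgebra A -> A f -> A g -> A (f - g).
Proof. by move=> sA Af Ag; rewrite -mulN1r -cstB1 -rmorphN; apply: saD => //; exact: saZ. Qed.

Lemma sa0 A : subalgebra A -> A 0.
Proof. by move=> sA; rewrite -cstB0; exact: saK. Qed.

Lemma sa_sum A (I : eqType) (r : seq I) (F : I -> B) : subalgebra A ->
  (forall i, i \in r -> A (F i)) -> A (\sum_(i <- r) F i).
Proof.
move=> sA AF; rewrite big_seq; elim/big_ind: _ => //; [exact: sa0|exact: saD].
Qed.

Lemma sa_prod A (I : eqType) (r : seq I) (F : I -> B) : subalgebra A ->
  (forall i, i \in r -> A (F i)) -> A (\prod_(i <- r) F i).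
Proof.
move=> sA AF; rewrite big_seq; elim/big_ind: _ => //; [exact: sa1|exact: saM].
Qed.

(* The value at a null [h] only has to make [cmean h] a state. *)
Definition cmean h f : R :=
  if Exp h == 0 then Exp f else Exp (f * h) / Exp h.

Lemma cmeanE h f : nneg h -> cmean h f * Exp h = Exp (f * h).
Proof.
move=> h0; rewrite /cmean; case: eqVneq => [Eh|Eh]; last by rewrite divfK.
by rewrite Eh mulr0 Exp_mul0.
Qed.

Lemma cmeanD h f g : cmean h (f + g) = cmean h f + cmean h g.
Proof.
rewrite /cmean; case: (Exp h == 0); first exact: ExpD.
by rewrite (mulrDl f) ExpD mulrDl.
Qed.

Lemma cmeanZ h c f : cmean h (c%:B * f) = c * cmean h f.
Proof.
rewrite /cmean; case: (Exp h == 0); first exact: ExpZ.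
by rewrite mulrA -ExpZ mulrA.
Qed.

Lemma cmean1 h : cmean h 1 = 1.
Proof. by rewrite /cmean; case: eqVneq => [|Eh]; rewrite ?Exp1// mul1r divff. Qed.

Lemma cmean_ge0 h f : nneg h -> nneg f -> 0 <= cmean h f.
Proof.
move=> h0 f0; rewrite /cmean; case: (Exp h == 0); first exact: Exp_ge0.
by rewrite divr_ge0// Exp_ge0//; exact: nnegM.
Qed.

(** [Exp ((f - b)^2 h)] is a quadratic in [b] with vertex at [cmean h f]. This allows [cvar] to be
    bounded by inserting any convenient constants in place of the means. *)
Lemma cmean_min h f c : nneg h ->
  Exp ((f - (cmean h f)%:B) ^+ 2 * h) <= Exp ((f - c%:B) ^+ 2 * h).
Proof.
move=> h0.
have E2 b : Exp ((f - b%:B) ^+ 2 * h) =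
    Exp (f ^+ 2 * h) - 2 * b * Exp (f * h) + b ^+ 2 * Exp h.
  rewrite -!ExpZ -ExpB -ExpD; congr Exp.
  by ring.
rewrite !E2 -(cmeanE f h0) -subr_ge0.
rewrite (_ : _ - _ = (c - cmean h f) ^+ 2 * Exp h); last by ring.
by rewrite mulr_ge0 ?sqr_ge0// Exp_ge0.
Qed.

Record pou (A : B -> Prop) H : Prop := {
  pou_nneg : forall h, h \in H -> nneg h;
  pou_in : forall h, h \in H -> A h;
  pou_sum : \sum_(h <- H) h = 1
}.

Definition cexp H f : B := \sum_(h <- H) (cmean h f)%:B * h.

(** If a point [x] draws the label [h] with probability [h x], this is the expected conditional
    variance of [f] given the label. *)
Definition cvar H f : R := \sum_(h <- H) Exp ((f - (cmean h f)%:B) ^+ 2 * h).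

Section Pou.
Variables (A : B -> Prop) (H : seq B).
Hypotheses (sA : subalgebra A) (pH : pou A H).

Lemma cexpD f g : cexp H (f + g) = cexp H f + cexp H g.
Proof.
by rewrite /cexp -big_split; apply: eq_bigr => h _; rewrite cmeanD rmorphD mulrDl.
Qed.

Lemma cexpZ c f : cexp H (c%:B * f) = c%:B * cexp H f.
Proof.
by rewrite /cexp mulr_sumr; apply: eq_bigr => h _; rewrite cmeanZ rmorphM mulrA.
Qed.

Lemma cexpB f g : cexp H (f - g) = cexp H f - cexp H g.
Proof. by rewrite -mulN1r -cstB1 -rmorphN cexpD cexpZ rmorphN cstB1 mulN1r. Qed.

Lemma cexp1 : cexp H 1 = 1.
Proof.
rewrite /cexp -[RHS](pou_sum pH).
by apply: eq_bigr => h _; rewrite cmean1 cstB1 mul1r.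
Qed.

Lemma cexp_nneg f : nneg f -> nneg (cexp H f).
Proof.
move=> f0; apply: nneg_sum => h hH; have h0 := pou_nneg pH hH.
by apply: nnegM => //; apply: nneg_cst; exact: cmean_ge0.
Qed.

Lemma cexp_in f : A (cexp H f).
Proof. by apply: sa_sum => // h hH; apply: saZ => //; exact: pou_in pH _ _. Qed.

Lemma Exp_cexp f : Exp (cexp H f) = Exp f.
Proof.
rewrite /cexp Exp_sum -[in RHS](mulr1 f) -(pou_sum pH) mulr_sumr Exp_sum.
apply: eq_big_seq => h hH; rewrite ExpZ; exact/cmeanE/(pou_nneg pH).
Qed.

(** Decomposition of a second moment around the mean: pointwise, [cexp H f] is the average of the
    constants [cmean h f] with weights [h], so the cross terms cancel. *)
Lemma cexp_dist f : Exp ((f - cexp H f) ^+ 2) <= cvar H f.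
Proof.
rewrite /cvar -Exp_sum; set g := cexp H f.
have S1 : \sum_(h <- H) (g - (cmean h f)%:B) * h = 0.
  under eq_bigr do rewrite mulrBl.
  rewrite sumrB -mulr_sumr (pou_sum pH) mulr1 -[X in X - _]/(cexp H f).
  exact: subrr.
have S2 : \sum_(h <- H) (f - (cmean h f)%:B) ^+ 2 * h =
    (f - g) ^+ 2 + \sum_(h <- H) (g - (cmean h f)%:B) ^+ 2 * h.
  transitivity (\sum_(h <- H) ((f - g) ^+ 2 * h
     + (2 * (f - g) * ((g - (cmean h f)%:B) * h)
     + (g - (cmean h f)%:B) ^+ 2 * h))).
    by apply: eq_bigr => h _; ring.
  by rewrite !big_split/= -!mulr_sumr S1 (pou_sum pH) mulr1 mulr0 add0r.
apply: Exp_le; rewrite S2 addrC addKr.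
by apply: nneg_sum => h hH; apply: nnegM; [exact: nneg_sqr|exact: pou_nneg pH _ _].
Qed.

Lemma cvar_le (c : B -> R) f :
  cvar H f <= \sum_(h <- H) Exp ((f - (c h)%:B) ^+ 2 * h).
Proof.
apply: ler_sum_seq => h hH.
exact/cmean_min/(pou_nneg pH).
Qed.

Lemma cvar_sqr f : cvar H f <= Exp (f ^+ 2).
Proof.
apply: (le_trans (cvar_le (fun=> 0) f)); rewrite -Exp_sum.
by rewrite -mulr_sumr (pou_sum pH) mulr1 cstB0 subr0.
Qed.

Lemma cvarD f g : cvar H (f + g) <= 2 * cvar H f + 2 * cvar H g.
Proof.
apply: (le_trans (cvar_le (fun h => cmean h f + cmean h g) _)).
apply: ler_sum_seq2 => h hH; rewrite -!ExpZ -ExpD; apply: Exp_le.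
rewrite rmorphD (_ : _ - _ = ((f - (cmean h f)%:B) - (g - (cmean h g)%:B)) ^+ 2 * h).
  by apply: nnegM; [exact: nneg_sqr|exact: pou_nneg pH _ _].
by ring.
Qed.

Lemma cvarZ c f : cvar H (c%:B * f) = c ^+ 2 * cvar H f.
Proof.
rewrite /cvar mulr_sumr; apply: eq_bigr => h _; rewrite -ExpZ; congr Exp.
by rewrite cmeanZ; ring.
Qed.

(** With [a] and [b] the means of [f] and [g], use [f g - a b = (f - a) g + a (g - b)]; here [g] is
    bounded by [N], and [a] by [M] because a mean is a state. *)
Lemma cvarM f g M N : nneg (M%:B - f) -> nneg (M%:B + f) ->
  nneg (N%:B - g) -> nneg (N%:B + g) ->
  cvar H (f * g) <= 2 * N ^+ 2 * cvar H f + 2 * M ^+ 2 * cvar H g.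
Proof.
move=> fM Mf gN Ng.
apply: (le_trans (cvar_le (fun h => cmean h f * cmean h g) _)).
apply: ler_sum_seq2 => h hH; have h0 := pou_nneg pH hH.
have : 0 <= M ^+ 2 - cmean h f ^+ 2.
  have := cmean_ge0 h0 fM; have := cmean_ge0 h0 Mf.
  rewrite -mulN1r -cstB1 -rmorphN -[M%:B]mulr1 !cmeanD !cmeanZ cmean1 mulr1 => u v.
  by rewrite subr_sqr mulr_ge0//; lra.
move: (cmean h f) (cmean h g) => a b aM.
rewrite -!ExpZ -ExpD; apply: Exp_le.
rewrite (_ : _ - _ = (2%:B * ((N%:B - g) * (N%:B + g)) * (f - a%:B) ^+ 2 +
   2%:B * (M ^+ 2 - a ^+ 2)%:B * (g - b%:B) ^+ 2 +
   ((f - a%:B) * g - a%:B * (g - b%:B)) ^+ 2) * h); last by ring.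
apply: nnegM => //; apply: nnegD; last exact: nneg_sqr.
have n2 : nneg (2%:B : B) by apply: nneg_cst.
apply: nnegD; apply: nnegM; try exact: nneg_sqr; apply: nnegM => //.
  exact: nnegM.
exact: nneg_cst.
Qed.

End Pou.

Lemma pouM A H1 H2 : subalgebra A -> pou A H1 -> pou A H2 ->
  pou A [seq g * h | g <- H1, h <- H2].
Proof.
move=> sA p1 p2; split.
- move=> _ /allpairsP[[g h]] /= [gH hH ->].
  by apply: nnegM; [exact: pou_nneg p1 _ _|exact: pou_nneg p2 _ _].
- move=> _ /allpairsP[[g h]] /= [gH hH ->].
  by apply: saM => //; [exact: pou_in p1 _ _|exact: pou_in p2 _ _].
- rewrite big_allpairs_dep/=; under eq_bigr do rewrite -mulr_sumr (pou_sum p2) mulr1.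
  exact: pou_sum p1.
Qed.

(** The constant attached to [g] serves every product [g * h], and by [cmean_min] the means of the
    products do at least as well. *)
Lemma cvar_refinel A H1 H2 f : subalgebra A -> pou A H1 -> pou A H2 ->
  cvar [seq g * h | g <- H1, h <- H2] f <= cvar H1 f.
Proof.
move=> sA p1 p2; rewrite /cvar big_allpairs_dep/=.
apply: ler_sum_seq => g gH.
apply: (@le_trans _ _ (\sum_(h <- H2) Exp ((f - (cmean g f)%:B) ^+ 2 * (g * h)))).
  apply: ler_sum_seq => h hH; apply: cmean_min.
  by apply: nnegM; [exact: pou_nneg p1 _ _|exact: pou_nneg p2 _ _].
by rewrite -Exp_sum -!mulr_sumr (pou_sum p2) mulr1.
Qed.

Lemma cvar_refiner A H1 H2 f : subalgebra A -> pou A H1 -> pou A H2 ->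
  cvar [seq g * h | g <- H1, h <- H2] f <= cvar H2 f.
Proof.
move=> sA p1 p2; apply: le_trans (cvar_refinel f sA p2 p1).
rewrite /cvar !big_allpairs_dep/= exchange_big/=.
rewrite le_eqVlt; apply/orP; left; apply/eqP.
by apply: eq_bigr => h _; apply: eq_bigr => g _; rewrite (mulrC g h).
Qed.

(** The functions that are nearly constant on the pieces of some partition taken from [A]. The class
    is closed under ring operations and L^2 limits, and [goodP] recovers approximation by elements
    of [A]. *)
Definition good A f := forall k : R, 0 < k -> exists2 H, pou A H & cvar H f <= k.

Section Good.
Variable A : B -> Prop.
Hypothesis sA : subalgebra A.

Lemma good_seq (L : seq B) (k : R) : 0 < k -> (forall f, f \in L -> good A f) ->
  exists2 H, pou A H & forall f, f \in L -> cvar H f <= k.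
Proof.
move=> k0; elim: L => [|f L IH] gL.
  exists [:: 1] => //; split; last by rewrite big_seq1.
    by move=> h /[!inE] /eqP ->; exact: nneg1.
  by move=> h /[!inE] /eqP ->; exact: sa1.
case: IH => [g gL'|H1 p1 H1k]; first by apply: gL; rewrite inE gL' orbT.
have [|H2 p2 H2k] := gL f _ k k0; first by rewrite inE eqxx.
exists [seq g * h | g <- H1, h <- H2]; first exact: pouM.
move=> g; rewrite inE => /predU1P[->|gL']; first exact: le_trans (cvar_refiner f sA p1 p2) _.
exact: le_trans (cvar_refinel g sA p1 p2) (H1k _ gL').
Qed.

Lemma goodD f g : good A f -> good A g -> good A (f + g).
Proof.
move=> gf gg k k0.
have [||H pH HL] := @good_seq [:: f; g] (k / 4); first by rewrite divr_gt0.
  by move=> h /[!inE] /orP[] /eqP ->.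
exists H => //; apply: (le_trans (cvarD pH _ _)).
have := HL f; have := HL g; rewrite !inE !eqxx orbT => /(_ isT) ? /(_ isT) ?.
lra.
Qed.

Lemma goodZ c f : good A f -> good A (c%:B * f).
Proof.
move=> gf k k0; have c0 : 0 < c ^+ 2 + 1 by rewrite ltr_wpDl ?sqr_ge0.
have [|H pH HL] := gf (k / (c ^+ 2 + 1)); first by rewrite divr_gt0.
exists H => //; rewrite cvarZ.
apply: (le_trans (ler_wpM2l (sqr_ge0 c) HL)).
by rewrite mulrA ler_pdivrMr// mulrC ler_wpM2l ?lerDl// ltW.
Qed.

Lemma goodN f : good A f -> good A (- f).
Proof. by move=> gf; rewrite -mulN1r -cstB1 -rmorphN; exact: goodZ. Qed.

Lemma goodB f g : good A f -> good A g -> good A (f - g).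
Proof. by move=> gf gg; apply: goodD => //; exact: goodN. Qed.

Lemma goodM f g : good A f -> good A g -> good A (f * g).
Proof.
move=> gf gg k k0; have [M M0 [fM Mf]] := pa_bounded f; have [N N0 [gN Ng]] := pa_bounded g.
pose e := k / (2 * N ^+ 2 + 2 * M ^+ 2).
have d0 : 0 < 2 * N ^+ 2 + 2 * M ^+ 2 by rewrite addr_gt0// mulr_gt0// exprn_gt0.
have [||H pH HL] := @good_seq [:: f; g] e; first by rewrite divr_gt0.
  by move=> h /[!inE] /orP[] /eqP ->.
exists H => //; apply: (le_trans (cvarM pH fM Mf gN Ng)).
have -> : k = 2 * N ^+ 2 * e + 2 * M ^+ 2 * e.
  by rewrite -mulrDl /e mulrCA divff ?mulr1// gt_eqF.
by rewrite lerD// ler_wpM2l ?HL ?inE ?eqxx ?orbT// mulr_ge0// sqr_ge0.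
Qed.

Lemma good_closed f : (forall k : R, 0 < k -> exists2 g, good A g & Exp ((f - g) ^+ 2) <= k) ->
  good A f.
Proof.
move=> fg k k0; have k4 : 0 < k / 4 by rewrite divr_gt0.
have [g gg fgk] := fg _ k4; have [H pH HL] := gg _ k4.
exists H => //; rewrite -(subrK g f); apply: (le_trans (cvarD pH _ _)).
have := le_trans (cvar_sqr pH (f - g)) fgk => ?; lra.
Qed.

Lemma goodP f (k : R) : good A f -> 0 < k -> exists2 g, A g & Exp ((f - g) ^+ 2) <= k.
Proof.
move=> gf /gf[H pH HL]; exists (cexp H f); first exact: cexp_in.
exact: le_trans (cexp_dist pH f) HL.
Qed.

(* Expanding [(y + (1 - y)) ^ n] into its [2 ^ n] terms; [p.1] counts the factors
   [y] in [p.2], and the last identity is the variance of the binomial law. *)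
Lemma bernoulli_partition (y : B) n : A y -> nneg y -> nneg (1 - y) ->
  exists L : seq (R * B), [/\ pou A [seq p.2 | p <- L] &
    \sum_(p <- L) (n%:R * y - p.1%:B) ^+ 2 * p.2 = n%:R * (y * (1 - y))].
Proof.
move=> Ay y0 y1; have Ay1 : A (1 - y) by apply: saB => //; exact: sa1.
elim: n => [|n [L [pL SL]]].
  exists [:: (0, 1)]; split; last by rewrite big_seq1/= cstB0 !mul0r subrr expr0n mul0r.
  split; last by rewrite big_seq1.
    by move=> h /[!inE] /eqP ->; exact: nneg1.
  by move=> h /[!inE] /eqP ->; exact: sa1.
exists ([seq (p.1 + 1, y * p.2) | p <- L] ++ [seq (p.1, (1 - y) * p.2) | p <- L]).
have S1 : \sum_(p <- L) p.2 = 1 by rewrite -(pou_sum pL) big_map.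
split; first split.
- move=> h; rewrite map_cat mem_cat => /orP[] /mapP[q /mapP[p pL' ->]] -> /=;
    by apply: nnegM => //; apply: (pou_nneg pL); exact: map_f.
- move=> h; rewrite map_cat mem_cat => /orP[] /mapP[q /mapP[p pL' ->]] -> /=;
    by apply: saM => //; apply: (pou_in pL); exact: map_f.
- rewrite map_cat big_cat/= -!map_comp !big_map/= -!mulr_sumr S1.
  by rewrite !mulr1 addrC subrK.
rewrite big_cat/= !big_map/= -big_split/=.
transitivity (\sum_(p <- L) ((n%:R * y - p.1%:B) ^+ 2 * p.2 + y * (1 - y) * p.2)).
  by apply: eq_bigr => p _; rewrite -natr1 rmorphD; ring.
rewrite big_split/= SL -mulr_sumr S1 mulr1.
by rewrite -natr1; ring.
Qed.

Lemma good_unitball f : A f -> unitball f -> good A f.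
Proof.
move=> Af [f1 f2]; pose y : B := 2^-1%:B * (1 + f).
have two : 2^-1%:B * 2 = 1 :> B by rewrite -(rmorph_nat (pa_cst B)) -cstBM mulVf ?cstB1.
have n2 : nneg (2^-1%:B : B) by apply: nneg_cst; rewrite invr_ge0.
have Ay : A y by apply: saZ => //; apply: saD => //; exact: sa1.
have y0 : nneg y by exact: nnegM.
have y1 : nneg (1 - y).
  by rewrite -two (_ : _ - y = 2^-1%:B * (1 - f)); [exact: nnegM|rewrite /y; ring].
suff gy : good A y.
  have -> : f = 2%:B * y + (- 1)%:B * 1.
    by rewrite /y mulrA [2%:B * _]mulrC rmorph_nat two; ring.
  apply: goodD; first exact: goodZ.
  (* Every partition has zero variance on a constant, so the empty list is enough to obtain one. *)
  apply: goodZ => k k0; have [||H pH _] := @good_seq [::] k => //.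
  exists H => //; apply: (le_trans (cvar_le pH (fun=> 1) _)).
  by rewrite cstB1 subrr expr0n/= big1 ?ltW// => h _; rewrite mul0r Exp0.
move=> k k0; pose C := Exp (y * (1 - y)).
have C0 : 0 <= C by apply/Exp_ge0/nnegM.
have [n nk] : exists n, C / n.+1%:R <= k.
  exists (Num.truncn (C / k)); rewrite ler_pdivrMr// mulrC -ler_pdivrMr//.
  by apply: ltW; exact: Num.Theory.truncnS_gt.
have [L [pL SL]] := bernoulli_partition n.+1 Ay y0 y1.
exists [seq p.2 | p <- L] => //; apply: le_trans nk.
have n0 : (n.+1%:R : R) != 0 by rewrite pnatr_eq0.
have nV : n.+1%:R^-1%:B * n.+1%:R = 1 :> B.
  by rewrite -(rmorph_nat (pa_cst B)) -cstBM mulVf ?cstB1.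
(* The binomial variance divided by the square of [n.+1]: on the piece [p.2], [y] is compared with
   the observed frequency [p.1 / n.+1]. *)
have -> : C / n.+1%:R = \sum_(p <- L) Exp ((y - (p.1 / n.+1%:R)%:B) ^+ 2 * p.2).
  rewrite -Exp_sum /C mulrC -ExpZ; congr Exp.
  transitivity (n.+1%:R^-1%:B * n.+1%:R^-1%:B * (n.+1%:R * (y * (1 - y))) : B).
    by rewrite -mulrA (mulrA _ n.+1%:R) nV mul1r.
  rewrite -SL mulr_sumr; apply: eq_bigr => p _.
  rewrite cstBM (_ : y - _ = n.+1%:R^-1%:B * (n.+1%:R * y - p.1%:B)); last first.
    by rewrite mulrBr mulrA nV mul1r [X in _ = _ - X]mulrC.
  by ring.
rewrite /cvar big_map; apply: ler_sum_seq => p pL'.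
by apply/cmean_min/(pou_nneg pL)/map_f.
Qed.

End Good.
End Partitions.

(** * Asymptotic homomorphisms *)

Section Vectors.
Context (R : realType) (d : nat).
Implicit Types x y : 'I_d -> R.

Definition meanv x : R := d%:R^-1 * \sum_(k < d) x k.

Definition msq x : R := meanv (fun k => x k ^+ 2).

Definition shiftv (u : 'S_d) x : 'I_d -> R := fun k => x (u^-1%g k).

Lemma meanv_le x y : (forall k, x k <= y k) -> meanv x <= meanv y.
Proof. by move=> xy; rewrite ler_wpM2l ?invr_ge0// ler_sum. Qed.

Lemma meanvD x y : meanv (fun k => x k + y k) = meanv x + meanv y.
Proof. by rewrite /meanv big_split mulrDr. Qed.

Lemma meanvZ c x : meanv (fun k => c * x k) = c * meanv x.
Proof. by rewrite /meanv -mulr_sumr mulrCA. Qed.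

Lemma msq_le_meanv x y : (forall k, x k ^+ 2 <= y k) -> msq x <= meanv y.
Proof. exact: meanv_le. Qed.

Lemma msq_ge0 x : 0 <= msq x.
Proof. by rewrite mulr_ge0 ?invr_ge0// sumr_ge0// => k _; exact: sqr_ge0. Qed.

Lemma msq_comb x y z a b : (forall k, z k ^+ 2 <= a * x k ^+ 2 + b * y k ^+ 2) ->
  msq z <= a * msq x + b * msq y.
Proof. by move=> zxy; rewrite -!meanvZ -meanvD; exact: meanv_le. Qed.

Lemma msqD x y : msq (x + y) <= 2 * msq x + 2 * msq y.
Proof.
apply: msq_comb => k; rewrite !fctE -subr_ge0.
by rewrite (_ : _ - _ = (x k - y k) ^+ 2) ?sqr_ge0//; ring.
Qed.

Lemma msq_tri x y z : msq (x - z) <= 2 * msq (x - y) + 2 * msq (y - z).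
Proof. by rewrite -(subrKA y) msqD. Qed.

Lemma msq_tri_le x y z a b : msq (x - y) <= a -> msq (y - z) <= b ->
  msq (x - z) <= 2 * a + 2 * b.
Proof. by move=> xa yb; apply: (le_trans (msq_tri _ y _)); rewrite lerD// ler_wpM2l. Qed.

Lemma msqZ c x : msq (fun k => c * x k) = c ^+ 2 * msq x.
Proof. by rewrite /msq -meanvZ; congr meanv; apply/funext => k; rewrite exprMn. Qed.

Lemma msqBC x y : msq (x - y) = msq (y - x).
Proof. by congr meanv; apply/funext => k; rewrite !fctE -sqrrN opprB. Qed.

Lemma msq_shift u x : msq (shiftv u x) = msq x.
Proof.
rewrite /msq /meanv (reindex_inj (@perm_inj _ u)); congr (_ * _).
by apply: eq_bigr => k _; rewrite /shiftv permK.
Qed.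

Lemma shiftvB u x y : shiftv u (x - y) = shiftv u x - shiftv u y.
Proof. by []. Qed.

End Vectors.

(** * Mean-square equality along a filter *)

Section AsymptoticEquality.
Context (R : realType) (I : Type) (F : set_system I) {FF : Filter F}.
Variable d : I -> nat.
Local Notation family := (forall i, 'I_(d i) -> R).
Implicit Types x y z : family.

Lemma near_seq (J : eqType) (s : seq J) (P : J -> I -> Prop) :
  (forall j, j \in s -> \forall i \near F, P j i) ->
  \forall i \near F, forall j, j \in s -> P j i.
Proof.
elim: s => [|j s IH] sP; first exact: nearW.
have Pj : \forall i \near F, P j i by apply: sP; rewrite inE eqxx.
have Ps : \forall i \near F, forall k, k \in s -> P k i.
  by apply: IH => k ks; apply: sP; rewrite inE ks orbT.
apply: filterS2 Pj Ps => i h1 h2 k.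
by rewrite inE => /predU1P[->|] //; exact: h2.
Qed.

Definition aeq x y := forall e : R, 0 < e -> \forall i \near F, msq (x i - y i) <= e.

Definition abnd x := exists M : R, \forall i \near F, forall k, `|x i k| <= M.

Lemma aeq_eq x y : (\forall i \near F, x i = y i) -> aeq x y.
Proof.
move=> xy e e0; apply: filterS xy => i ->; rewrite subrr /msq /meanv big1 ?mulr0 ?ltW//.
by move=> k _; rewrite expr0n.
Qed.

Lemma aeq_refl x : aeq x x.
Proof. by apply: aeq_eq; apply: nearW. Qed.

Lemma aeq_sym x y : aeq x y -> aeq y x.
Proof. by move=> xy e /xy; apply: filterS => i; rewrite msqBC. Qed.

Lemma aeq_extr x y y' : (forall i, y' i = y i) -> aeq x y -> aeq x y'.
Proof. by move=> yy xy e /xy; apply: filterS => i; rewrite yy. Qed.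

Lemma aeq_trans y x z : aeq x y -> aeq y z -> aeq x z.
Proof.
move=> xy yz e e0; have e4 : 0 < e / 4 by rewrite divr_gt0.
apply: filterS2 (xy _ e4) (yz _ e4) => i u v.
by apply: (le_trans (msq_tri _ (y i) _)); lra.
Qed.

Lemma aeqD x x' y y' : aeq x x' -> aeq y y' ->
  aeq (fun i => x i + y i) (fun i => x' i + y' i).
Proof.
move=> xx yy e e0; have e4 : 0 < e / 4 by rewrite divr_gt0.
apply: filterS2 (xx _ e4) (yy _ e4) => i u v.
rewrite opprD addrACA; apply: (le_trans (msqD _ _)); lra.
Qed.

Lemma aeqZ c x x' : aeq x x' -> aeq (fun i k => c * x i k) (fun i k => c * x' i k).
Proof.
move=> xx e e0; have c0 : 0 < c ^+ 2 + 1 by rewrite ltr_wpDl ?sqr_ge0.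
have e1 : 0 < e / (c ^+ 2 + 1) by rewrite divr_gt0.
apply: filterS (xx _ e1) => i; rewrite ler_pdivlMr// mulrC; apply: le_trans.
rewrite (_ : _ - _ = (fun k => c * (x i - x' i) k)); last first.
  by apply/funext => k; rewrite !fctE mulrBr.
by rewrite msqZ ler_wpM2r ?msq_ge0// lerDl.
Qed.

(** Mean-square closeness survives products only with uniform bounds:
    [x y - x' y' = (x - x') y + x' (y - y')] calls for bounds on [y] and [x']. *)
Lemma aeqM x x' y y' : abnd x' -> abnd y -> aeq x x' -> aeq y y' ->
  aeq (fun i => x i * y i) (fun i => x' i * y' i).
Proof.
move=> [M xM] [N yN] xx yy e e0.
pose c := 2 * N ^+ 2 + 2 * M ^+ 2 + 1.
have c0 : 0 < c by rewrite ltr_wpDl// addr_ge0// mulr_ge0// sqr_ge0.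
have e1 : 0 < e / c by rewrite divr_gt0.
apply: filterS2 (filterI xM yN) (filterI (xx _ e1) (yy _ e1)) => i [iM iN] [u v].
apply: (@le_trans _ _ (2 * N ^+ 2 * msq (x i - x' i) + 2 * M ^+ 2 * msq (y i - y' i))).
  apply: msq_comb => k; rewrite !fctE.
  move: (iM k) (iN k); rewrite !ler_norml => /andP[Ma Mb] /andP[Na Nb].
  move: (x i k) (x' i k) (y i k) (y' i k) Ma Mb Na Nb => a b p q Ma Mb Na Nb.
  rewrite -subr_ge0 (_ : _ - _ = 2 * ((N - p) * (N + p)) * (a - b) ^+ 2 +
   2 * ((M - b) * (M + b)) * (p - q) ^+ 2 + ((a - b) * p - b * (p - q)) ^+ 2); last by ring.
  have hN : 0 <= (N - p) * (N + p) by apply: mulr_ge0; lra.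
  have hM : 0 <= (M - b) * (M + b) by apply: mulr_ge0; lra.
  apply: addr_ge0; last exact: sqr_ge0.
  by apply: addr_ge0; apply: mulr_ge0; rewrite ?sqr_ge0// mulr_ge0.
have N0 : 0 <= 2 * N ^+ 2 by rewrite mulr_ge0// sqr_ge0.
have M0 : 0 <= 2 * M ^+ 2 by rewrite mulr_ge0// sqr_ge0.
apply: (le_trans (lerD (ler_wpM2l N0 u) (ler_wpM2l M0 v))).
by rewrite -mulrDl mulrCA ger_pMr// ler_pdivrMr// mul1r /c lerDl.
Qed.

Lemma abnd_prod (J : Type) (s : seq J) (u : J -> family) :
  (forall j, abnd (u j)) -> abnd (fun i => \prod_(j <- s) u j i).
Proof.
move=> ub; elim: s => [|j s [M IH]].
  by exists 1; apply: nearW => i k; rewrite big_nil -[leLHS]/(`|1 : R|) normr1.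
have [N uN] := ub j; exists (N * M); move: uN IH; apply: filterS2 => i a b k.
by rewrite big_cons fctE normrM ler_pM.
Qed.

Lemma aeq_prod (J : eqType) (s : seq J) (u v : J -> family) :
  (forall j, abnd (u j)) -> (forall j, abnd (v j)) ->
  (forall j, j \in s -> aeq (u j) (v j)) ->
  aeq (fun i => \prod_(j <- s) u j i) (fun i => \prod_(j <- s) v j i).
Proof.
move=> ub vb; elim: s => [|j s IH] uv.
  by apply: aeq_eq; apply: nearW => i; rewrite !big_nil.
apply: (@aeq_trans (fun i => u j i * \prod_(j <- s) u j i)).
  by apply: aeq_eq; apply: nearW => i; rewrite !big_cons.
apply: (@aeq_trans (fun i => v j i * \prod_(j <- s) v j i)); last first.
  by apply: aeq_eq; apply: nearW => i; rewrite !big_cons.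
apply: aeqM => //; first exact: abnd_prod.
  by apply: uv; rewrite inE eqxx.
by apply: IH => k ks; apply: uv; rewrite inE ks orbT.
Qed.

Lemma aeq_shift (u : forall i, 'S_(d i)) x y : aeq x y ->
  aeq (fun i => shiftv (u i) (x i)) (fun i => shiftv (u i) (y i)).
Proof. by move=> xy e /xy; apply: filterS => i; rewrite -shiftvB msq_shift. Qed.

Lemma abnd_shift (u : forall i, 'S_(d i)) x : abnd x ->
  abnd (fun i => shiftv (u i) (x i)).
Proof. by move=> [M xM]; exists M; apply: filterS xM => i xM k; exact: xM. Qed.

End AsymptoticEquality.

Section UnitalPositive.
Context (R : realType) (B : palg R) (d : nat).

Record ustate (phi : B -> 'I_d -> R) : Prop := {
  usD : forall f g, phi (f + g) = phi f + phi g;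
  usZ : forall c f k, phi (c%:B * f) k = c * phi f k;
  us1 : forall k, phi 1 k = 1;
  us_ge0 : forall f k, nneg f -> 0 <= phi f k
}.

Implicit Types f g h : B.
Variable phi : B -> 'I_d -> R.
Hypothesis us : ustate phi.

Lemma usDk f g k : phi (f + g) k = phi f k + phi g k.
Proof. by rewrite (usD us). Qed.

Lemma usN f k : phi (- f) k = - phi f k.
Proof. by rewrite -mulN1r -cstB1 -rmorphN usZ// mulN1r. Qed.

Lemma usB f g : phi (f - g) = phi f - phi g.
Proof. by apply/funext => k; rewrite usDk usN. Qed.

Lemma us0 k : phi 0 k = 0.
Proof. by rewrite -[0](mul0r 0) -cstB0 usZ// mul0r. Qed.

Lemma us_cst c k : phi c%:B k = c.
Proof. by rewrite -[c%:B]mulr1 usZ// us1// mulr1. Qed.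

Lemma us_bound f M k : nneg (M%:B - f) -> nneg (M%:B + f) -> `|phi f k| <= M.
Proof.
move=> /(us_ge0 us k) + /(us_ge0 us k); rewrite !usDk usN us_cst => u v.
by rewrite ler_norml; apply/andP; split; lra.
Qed.

(** Cauchy-Schwarz for the state [phi _ k]: positivity applied to the square of [f] minus its own
    value [phi f k]. *)
Lemma us_sqr f k : phi f k ^+ 2 <= phi (f ^+ 2) k.
Proof.
have := us_ge0 us k (nneg_sqr (f - (phi f k)%:B)).
rewrite (_ : _ ^+ 2 = f ^+ 2 + (- 2 * phi f k)%:B * f + (phi f k ^+ 2)%:B); last first.
  by ring.
rewrite !usDk usZ// us_cst => h; lra.
Qed.

Lemma us_msq f : msq (phi f) <= meanv (phi (f ^+ 2)).
Proof. by apply: msq_le_meanv => k; exact: us_sqr. Qed.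

Lemma us_cexp A H : pou A H -> ustate (phi \o cexp H).
Proof.
move=> pH; split=> /=.
- by move=> f g; rewrite cexpD usD.
- by move=> c f k; rewrite cexpZ usZ.
- by move=> k; rewrite (cexp1 pH) us1.
- by move=> f k f0; apply: us_ge0 => //; exact: cexp_nneg pH _ _.
Qed.

End UnitalPositive.

Record paction (R : realFieldType) (G : groupType) (B : palg R) := Paction {
  pact :> G -> {rmorphism B -> B};
  pact_cst : forall s c, pact s c%:B = c%:B;
  pact_nneg : forall s f, nneg f -> nneg (pact s f);
  pact_Exp : forall s f, Exp (pact s f) = Exp f;
  pact1 : forall f, pact 1%g f = f;
  pactM : forall s t f, pact (s * t)%g f = pact s (pact t f)
}.

(** * The algebra of words in the translates *)

Section Words.
Context (R : realType) (G : groupType) (B : palg R) (T : paction G B).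
Variable x : nat -> B.
Hypothesis x1 : forall n, unitball (x n).
Implicit Types f g h : B.

Definition letter (a : G * nat) : B := T a.1 (x a.2).
Definition pword (l : seq (G * nat)) : B := \prod_(a <- l) letter a.
Definition translate (s : G) (l : seq (G * nat)) := [seq ((s * a.1)%g, a.2) | a <- l].

Lemma pword_cat l1 l2 : pword (l1 ++ l2) = pword l1 * pword l2.
Proof. exact: big_cat. Qed.

Lemma pact_pword s l : T s (pword l) = pword (translate s l).
Proof.
rewrite /pword rmorph_prod big_map; apply: eq_bigr => a _.
by rewrite /letter/= pactM.
Qed.

Lemma pact_unit s f : unitball f -> unitball (T s f).
Proof.
move=> [f1 f2]; rewrite /unitball -(rmorph1 (T s)) -rmorphD -rmorphB.
by split; exact: pact_nneg.
Qed.

(** Both bounds come from sums of products in the cone, such as [2 (1 - f g) = (1 - f) (1 + g) + (1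
    + f) (1 - g)]. *)
Lemma mul_unit f g : unitball f -> unitball g ->
  unitball (f * g).
Proof.
move=> [f1 f2] [g1 g2].
have h : nneg (2^-1%:B : B) by apply: nneg_cst; rewrite invr_ge0.
have two : 2^-1%:B * 2 = 1 :> B by rewrite -(rmorph_nat (pa_cst B)) -cstBM mulVf ?cstB1.
have half (u v : B) : u = 2 * v -> 2^-1%:B * u = v by move=> ->; rewrite mulrA two mul1r.
split.
  rewrite -(half ((1 - f) * (1 + g) + (1 + f) * (1 - g)) (1 - f * g)); last by ring.
  by apply: nnegM => //; apply: nnegD; exact: nnegM.
rewrite -(half ((1 - f) * (1 - g) + (1 + f) * (1 + g)) (1 + f * g)); last by ring.
by apply: nnegM => //; apply: nnegD; exact: nnegM.
Qed.

Lemma letter_unit a : unitball (letter a).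
Proof. exact: pact_unit (x1 _). Qed.

Lemma one_unit : unitball (1 : B).
Proof. by rewrite /unitball subrr; split; [exact: nneg0|apply: nnegD; exact: nneg1]. Qed.

Lemma prod_unit (J : Type) (s : seq J) (u : J -> B) :
  (forall j, unitball (u j)) ->
  unitball (\prod_(j <- s) u j).
Proof. by move=> h; elim/big_ind: _ => [|*|*//]; [exact: one_unit|exact: mul_unit]. Qed.

(** Adding one monomial at a time makes every linear statement an induction whose only real content
    is the case of a single word. *)
Inductive walg : B -> Prop :=
| walg0 : walg 0
| walg_cons c l f : walg f -> walg (c%:B * pword l + f).

Lemma walg_word l : walg (pword l).
Proof. by rewrite -[pword l]mul1r -cstB1 -[X in walg X]addr0; do 2 constructor. Qed.

Lemma walgD f g : walg f -> walg g -> walg (f + g).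
Proof.
move=> wf wg; elim: wf => [|c l h _ IH]; first by rewrite add0r.
by rewrite -addrA; constructor.
Qed.

Lemma walg_pwordM c l g : walg g -> walg (c%:B * pword l * g).
Proof.
elim=> [|c' l' h _ IH]; first by rewrite mulr0; exact: walg0.
rewrite mulrDr [X in X + _](_ : _ = (c * c')%:B * pword (l ++ l')); last first.
  by rewrite pword_cat; ring.
exact: walg_cons.
Qed.

Lemma walgM f g : walg f -> walg g -> walg (f * g).
Proof.
move=> wf wg; elim: wf => [|c l h _ IH]; first by rewrite mul0r; exact: walg0.
by rewrite mulrDl; apply: walgD => //; exact: walg_pwordM.
Qed.

Lemma walg_subalgebra : subalgebra walg.
Proof.
split; [|exact: walgD|exact: walgM|].
  by have := walg_word [::]; rewrite /pword big_nil.
move=> c; rewrite (_ : c%:B = c%:B * pword [::] + 0); first by do 2 constructor.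
by rewrite /pword big_nil mulr1 addr0.
Qed.

Lemma walg_letter a : walg (letter a).
Proof.
rewrite (_ : letter a = pword [:: a]); first exact: walg_word.
by rewrite /pword big_seq1.
Qed.

Lemma walg_pact s f : walg f -> walg (T s f).
Proof.
elim=> [|c l h _ IH]; first by rewrite rmorph0; exact: walg0.
by rewrite rmorphD rmorphM pact_cst pact_pword; exact: walg_cons.
Qed.

Lemma good_letter a : good walg (letter a).
Proof.
by apply: (good_unitball walg_subalgebra); [exact: walg_letter|exact: letter_unit].
Qed.

Lemma good_pword l : good walg (pword l).
Proof.
rewrite /pword; elim/big_ind: _ => [|f g|a _]; last exact: good_letter.
  apply: (good_unitball walg_subalgebra); last exact: one_unit.
  exact: (sa1 walg_subalgebra).
exact/goodM/walg_subalgebra.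
Qed.

Lemma good_walg f : walg f -> good walg f.
Proof.
elim=> [|c l h _ IH].
  rewrite -(mul0r (pword [::])) -cstB0.
  by apply: goodZ; exact: good_pword.
apply: (goodD walg_subalgebra) => //.
by apply: goodZ; exact: good_pword.
Qed.

End Words.

Section AsymptoticHomomorphisms.
Context (R : realType) (G : groupType) (B : palg R) (T : paction G B).
Variables (I : Type) (F : set_system I).
Context {FF : Filter F}.
Variables (d : I -> nat) (sigma : forall i, G -> 'S_(d i)).

(** The index set will contain arbitrary maps, so even being a state is only an eventual
    property. *)
Record asym (x : nat -> B) (phi : forall i, B -> 'I_(d i) -> R) : Prop := {
  as_us : \forall i \near F, ustate (phi i);
  as_word : forall l, aeq F (fun i => phi i (pword T x l))
                            (fun i => \prod_(a <- l) phi i (letter T x a));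
  as_mean : forall l e, 0 < e ->
    \forall i \near F, `|meanv (phi i (pword T x l)) - Exp (pword T x l)| <= e;
  as_shift : forall s n, aeq F (fun i => phi i (T s (x n)))
                               (fun i => shiftv (sigma i s) (phi i (x n)))
}.

Definition sofic_along : Prop := forall s t (e : R), 0 < e -> \forall i \near F,
  #|[pred k | sigma i (s * t)%g k != sigma i s (sigma i t k)]|%:R / (d i)%:R <= e.

Variable x : nat -> B.
Hypothesis x1 : forall n, unitball (x n).
Implicit Types f g h : B.
Variable phi : forall i, B -> 'I_(d i) -> R.
Arguments phi : clear implicits.
Hypothesis Hphi : asym x phi.

Lemma as_bnd f : abnd F (fun i => phi i f).
Proof.
have [M M0 [f1 f2]] := pa_bounded f; exists M.
by apply: filterS (as_us Hphi) => i us k; exact: us_bound.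
Qed.

Lemma as_lin c f g : aeq F (fun i => phi i (c%:B * f + g))
  (fun i => (fun k => c * phi i f k) + phi i g).
Proof.
apply: aeq_eq; apply: filterS (as_us Hphi) => i us.
by apply/funext => k; rewrite (usDk us) (usZ us).
Qed.

Lemma as_word2 l1 l2 : aeq F (fun i => phi i (pword T x l1 * pword T x l2))
  (fun i => phi i (pword T x l1) * phi i (pword T x l2)).
Proof.
rewrite -pword_cat; apply: aeq_trans (as_word Hphi _) _.
apply: aeq_sym; apply: aeq_extr => [i|]; first exact: big_cat.
apply: aeqM; try exact: as_word.
  by apply: abnd_prod => a; exact: as_bnd.
exact: as_bnd.
Qed.

(** Words multiply by concatenation, so the case of two words follows from [as_word]; the rest is
    bilinearity, with [lin] performing one inductive step in the left factor. *)
Lemma as_mul f g : walg T x f -> walg T x g ->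
  aeq F (fun i => phi i (f * g)) (fun i => phi i f * phi i g).
Proof.
have lin c (h h' : B) (u v w : forall i, 'I_(d i) -> R) :
    aeq F (fun i => phi i h) (fun i => u i * w i) ->
    aeq F (fun i => phi i h') (fun i => v i * w i) ->
    aeq F (fun i => phi i (c%:B * h + h'))
          (fun i => ((fun k => c * u i k) + v i) * w i).
  move=> hu hv; apply: aeq_trans (as_lin _ _ _) _.
  apply: (aeq_trans (aeqD (aeqZ c hu) hv)); apply: aeq_eq; apply: nearW => i.
  by apply/funext => k; rewrite !fctE mulrDl mulrA.
have bl c h : abnd F (fun i => (fun k => c * phi i h k) : 'I_(d i) -> R).
  have [M hM] := as_bnd h; exists (`|c| * M); apply: filterS hM => i hM k.
  by rewrite normrM ler_wpM2l.
have bD (u v : forall i, 'I_(d i) -> R) : abnd F u -> abnd F v -> abnd F (fun i => u i + v i).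
  move=> [M hM] [N hN]; exists (M + N); apply: filterS2 hM hN => i hM hN k.
  by rewrite (le_trans (ler_normD _ _))// lerD.
have as0 h : aeq F (fun i => phi i (0 * h)) (fun i => phi i 0 * phi i h).
  apply: aeq_eq; apply: filterS (as_us Hphi) => i us; apply/funext => k.
  by rewrite mul0r !fctE (us0 us) mul0r.
have wmul l : walg T x g -> aeq F (fun i => phi i (pword T x l * g))
    (fun i => phi i (pword T x l) * phi i g).
  elim=> [|c l' h _ IH].
    by rewrite mulrC; apply: (aeq_extr _ (as0 _)) => i; exact: mulrC.
  rewrite (_ : _ * _ = c%:B * (pword T x l' * pword T x l) + pword T x l * h); last by ring.
  apply: aeq_extr => [i|]; first exact: mulrC.
  apply: (@aeq_trans _ _ _ _ _
    (fun i => ((fun k => c * phi i (pword T x l') k) + phi i h) * phi i (pword T x l))).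
    apply: lin; first exact: as_word2.
    by apply: (aeq_extr _ IH) => i; exact: mulrC.
  apply: aeqM; [exact: as_bnd|exact: as_bnd| |exact: aeq_refl].
  by apply: aeq_sym; exact: as_lin.
move=> wf wg; elim: wf => [|c l h _ IH]; first exact: as0.
rewrite mulrDl -mulrA.
apply: (@aeq_trans _ _ _ _ _
    (fun i => ((fun k => c * phi i (pword T x l) k) + phi i h) * phi i g)).
  by apply: lin; [exact: wmul|exact: IH].
apply: aeqM; [exact: as_bnd|exact: as_bnd| |exact: aeq_refl].
by apply: aeq_sym; exact: as_lin.
Qed.

Lemma as_prod (J : Type) (s : seq J) (u : J -> B) : (forall j, walg T x (u j)) ->
  aeq F (fun i => phi i (\prod_(j <- s) u j)) (fun i => \prod_(j <- s) phi i (u j)).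
Proof.
move=> wu; elim: s => [|j s IH].
  apply: aeq_eq; apply: filterS (as_us Hphi) => i us; apply/funext => k.
  by rewrite !big_nil us1.
rewrite big_cons; apply: aeq_extr => [i|]; first exact: big_cons.
apply: (aeq_trans (as_mul (wu j) _)).
  by elim/big_ind: _ => [|*|*//]; [exact: sa1 (walg_subalgebra _ _)|exact: walgM].
by apply: aeqM => //; [exact: as_bnd|exact: as_bnd|exact: aeq_refl].
Qed.

Lemma as_exp f e : walg T x f -> 0 < e ->
  \forall i \near F, `|meanv (phi i f) - Exp f| <= e.
Proof.
move=> wf; elim: wf e => [|c l h _ IH] e e0.
  apply: filterS (as_us Hphi) => i us; rewrite Exp0 subr0 /meanv big1 ?mulr0 ?normr0 ?ltW//.
  by move=> k _; exact: us0.
have c0 : 0 < 2 * (`|c| + 1) by rewrite mulr_gt0// ltr_wpDl.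
have e1 : 0 < e / (2 * (`|c| + 1)) by rewrite divr_gt0.
have e2 : 0 < e / 2 by rewrite divr_gt0.
apply: filterS3 (as_us Hphi) (as_mean Hphi l e1) (IH _ e2) => i us u v.
have -> : meanv (phi i (c%:B * pword T x l + h)) =
    c * meanv (phi i (pword T x l)) + meanv (phi i h).
  by rewrite -meanvZ -meanvD; congr meanv; apply/funext => k; rewrite (usDk us) (usZ us).
rewrite ExpD ExpZ opprD addrACA -mulrBr (le_trans (ler_normD _ _))// normrM.
rewrite [e]splitr lerD//.
move: u; rewrite ler_pdivlMr// => u.
have := ler_wpM2l (normr_ge0 c) (lexx `|meanv (phi i (pword T x l)) - Exp (pword T x l)|).
move: (normr_ge0 (meanv (phi i (pword T x l)) - Exp (pword T x l))) u.
by move: `|_| `|_| => a b; nra.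
Qed.

(** The passage of L^2 smallness through [phi]: Cauchy-Schwarz bounds [msq (phi f)] by the mean of
    [phi (f ^+ 2)], and [f ^+ 2] is still in the algebra where means are controlled. *)
Lemma as_small f e : walg T x f -> Exp (f ^+ 2) < e ->
  \forall i \near F, msq (phi i f) <= e.
Proof.
move=> wf fe; have e0 : 0 < e - Exp (f ^+ 2) by rewrite subr_gt0.
have := as_exp (walgM wf wf) e0; rewrite -expr2.
apply: filterS2 (as_us Hphi) => i us; rewrite ler_norml => /andP[_ h].
apply: (le_trans (us_msq us f)); lra.
Qed.

Hypothesis Hsofic : sofic_along.

(** The two sides can differ only where the permutations disagree, a vanishing proportion of points,
    and there by at most [2 M]. *)
Lemma aeq_sofic (y : forall i, 'I_(d i) -> R) s t : abnd F y ->
  aeq F (fun i => shiftv (sigma i (s * t)%g) (y i))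
        (fun i => shiftv (sigma i s) (shiftv (sigma i t) (y i))).
Proof.
move=> [M yM] e e0; pose c := 4 * M ^+ 2 + 1.
have c0 : 0 < c by rewrite ltr_wpDl// mulr_ge0// sqr_ge0.
have e1 : 0 < e / c by rewrite divr_gt0.
apply: filterS2 yM (Hsofic s t e1) => i yM; rewrite ler_pdivlMr// => h.
apply: le_trans h; rewrite -sum1_card natr_sum mulrAC mulrC mulr_suml.
rewrite /msq /meanv ler_wpM2l ?invr_ge0//.
(* Shifts involve inverse permutations and the sofic condition the permutations themselves; this
   change of variable turns the set of disagreement into the one that is counted. *)
rewrite (reindex_inj (@perm_inj _ (sigma i (s * t)%g))).
rewrite [leRHS]big_mkcond; apply: ler_sum => k _.
rewrite !fctE /shiftv permK mul1r; case: ifPn => [_|/negPn/eqP ->]; last first.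
  by rewrite !permK subrr expr0n.
move: (yM k) (yM ((sigma i t)^-1 ((sigma i s)^-1 (sigma i (s * t) k)))%g).
rewrite !ler_norml => /andP[a1 a2] /andP[b1 b2].
move: (y i _) (y i _) a1 a2 b1 b2 => a b a1 a2 b1 b2.
have := mulr_ge0 (_ : 0 <= 2 * M - (a - b)) (_ : 0 <= 2 * M + (a - b)).
rewrite /c => /(_ _ _)/wrap[]; [lra|lra|nra].
Qed.

Lemma as_equi f s : walg T x f ->
  aeq F (fun i => phi i (T s f)) (fun i => shiftv (sigma i s) (phi i f)).
Proof.
have bs g (u : G) : abnd F (fun i => shiftv (sigma i u) (phi i g)).
  exact: abnd_shift (as_bnd g).
(* [as_shift] speaks of [x n] only. For a letter that is already a translate by [t] it is used for
   [s * t] and for [t], and [aeq_sofic] reconciles the two. *)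
have lett a : aeq F (fun i => phi i (T s (letter T x a)))
    (fun i => shiftv (sigma i s) (phi i (letter T x a))).
  have h := as_shift Hphi a.1 a.2.
  rewrite /letter -pactM; apply: aeq_trans (as_shift Hphi _ _) _.
  apply: aeq_trans (aeq_sofic _ _ (as_bnd (x a.2))) _.
  exact: (aeq_shift (fun i => sigma i s) (aeq_sym h)).
have words l : aeq F (fun i => phi i (T s (pword T x l)))
    (fun i => shiftv (sigma i s) (phi i (pword T x l))).
  rewrite /pword rmorph_prod.
  apply: (aeq_trans (as_prod _ (fun a => walg_pact s (walg_letter T x a)))).
  apply: (@aeq_trans _ _ _ _ _ (fun i => shiftv (sigma i s) (\prod_(a <- l) phi i (letter T x a)))).
    apply: (@aeq_trans _ _ _ _ _
      (fun i => \prod_(a <- l) shiftv (sigma i s) (phi i (letter T x a)))).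
      by apply: aeq_prod => *; [exact: as_bnd|exact: bs|exact: lett].
    apply: aeq_eq; apply: nearW => i; apply/funext => k; rewrite /shiftv.
    by elim: l => [|a l IH]; rewrite ?big_nil// !big_cons !fctE IH.
  exact: (aeq_shift (fun i => sigma i s) (aeq_sym (as_word Hphi l))).
elim=> [|c l h _ IH].
  apply: aeq_eq; apply: filterS (as_us Hphi) => i us; apply/funext => k.
  by rewrite rmorph0 /shiftv !(us0 us).
rewrite rmorphD rmorphM pact_cst; apply: aeq_trans (as_lin _ _ _) _.
apply: (aeq_trans (aeqD (aeqZ c (words l)) IH)).
exact: (aeq_shift (fun i => sigma i s) (aeq_sym (as_lin c (pword T x l) h))).
Qed.

(* On the algebra of words, maps that agree asymptotically on the generators agree
   asymptotically. *)
Lemma as_continuity (psi : forall i, B -> 'I_(d i) -> R) f : asym x psi ->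
  (forall n, aeq F (fun i => phi i (x n)) (fun i => psi i (x n))) -> walg T x f ->
  aeq F (fun i => phi i f) (fun i => psi i f).
Proof.
move=> Hpsi xe; elim=> [|c l h _ IH].
  apply: aeq_eq; apply: filterS2 (as_us Hphi) (as_us Hpsi) => i u v.
  by apply/funext => k; rewrite (us0 u) (us0 v).
have bpsi g : abnd F (fun i => psi i g).
  have [M M0 [f1 f2]] := pa_bounded g; exists M.
  by apply: filterS (as_us Hpsi) => i us k; exact: us_bound.
apply: aeq_trans (as_lin _ _ _) _.
apply: (@aeq_trans _ _ _ _ _ (fun i => (fun k => c * psi i (pword T x l) k) + psi i h)).
  apply: aeqD => //; apply: aeqZ.
  apply: aeq_trans (as_word Hphi _) _; apply: aeq_sym.
  apply: aeq_trans (as_word Hpsi _) _; apply: aeq_sym.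
  apply: aeq_prod => a *; [exact: as_bnd|exact: bpsi|].
  apply: aeq_trans (as_shift Hphi _ _) _; apply: aeq_sym.
  apply: aeq_trans (as_shift Hpsi _ _) _.
  exact: (aeq_shift (fun i => sigma i a.1) (aeq_sym (xe a.2))).
apply: aeq_eq; apply: filterS (as_us Hpsi) => i us.
by apply/funext => k; rewrite (usDk us) (usZ us).
Qed.

End AsymptoticHomomorphisms.

(** * Transfer of an asymptotic homomorphism to another sequence *)

Section Transfer.
Context (R : realType) (G : groupType) (B : palg R) (T : paction G B).
Variables (I : Type) (F : set_system I).
Context {FF : Filter F}.
Variables (d : I -> nat) (sigma : forall i, G -> 'S_(d i)).
Variables (x y : nat -> B).
Hypotheses (x1 : forall n, unitball (x n)) (y1 : forall n, unitball (y n)).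
Variable phi : forall i, B -> 'I_(d i) -> R.
Arguments phi : clear implicits.
Hypotheses (Hphi : asym T F sigma x phi) (Hsofic : sofic_along R F sigma).
Implicit Types f g h : B.

Let sA : subalgebra (walg T x) := walg_subalgebra T x.

Variable H : seq B.
Hypothesis pH : pou (walg T x) H.

Lemma cexp_unitball f : unitball f -> unitball (cexp H f).
Proof.
move=> [f1 f2]; rewrite /unitball -(cexp1 pH) -cexpD -cexpB.
by split; exact: cexp_nneg pH _ _.
Qed.

(** Factors are exchanged one at a time; each exchange costs [2 k + 2 K <= 4 K], where [K] bounds
    the previous error and is at least [k]. *)
Lemma Exp_prod_dist (J : eqType) (s : seq J) (u v : J -> B) (k : R) : 0 <= k ->
  (forall j, unitball (u j)) -> (forall j, unitball (v j)) ->
  (forall j, j \in s -> Exp ((u j - v j) ^+ 2) <= k) ->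
  Exp ((\prod_(j <- s) u j - \prod_(j <- s) v j) ^+ 2) <= 4 ^+ size s * k.
Proof.
move=> k0 u1 v1; elim: s => [|j s IH] uv.
  by rewrite !big_nil subrr expr0n/= Exp0 mul1r.
rewrite !big_cons; have {}IH := IH (fun i si => uv i (@mem_behead _ (j :: s) i si)).
have uj : Exp ((u j - v j) ^+ 2) <= k by apply: uv; rewrite inE eqxx.
apply: (le_trans (Exp_sqr_tri (v j * \prod_(j <- s) u j) _ _)).
rewrite -mulrBl -mulrBr [v j * _]mulrC.
have h1 := le_trans (Exp_sqrM (u j - v j) (prod_unit s u1)) uj.
have h2 := le_trans (Exp_sqrM (\prod_(j <- s) u j - \prod_(j <- s) v j) (v1 j)) IH.
have k4 : k <= 4 ^+ size s * k by rewrite ler_peMl// exprn_ege1// ler1n.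
have -> : 4 ^+ size (j :: s) * k = 4 * (4 ^+ size s * k) by rewrite mulrA -exprS.
move: (4 ^+ size s * k) h2 k4 => K h2 k4; lra.
Qed.

Lemma Exp_cexp_sqr f : Exp (cexp H f ^+ 2) <= 4 * Exp (f ^+ 2).
Proof.
have h := Exp_sqrD (cexp H f - f) f.
rewrite subrK Exp_sqrBC in h; apply: (le_trans h).
have := le_trans (cexp_dist pH f) (cvar_sqr pH f); lra.
Qed.

Lemma transfer_state : \forall i \near F, ustate (phi i \o cexp H).
Proof. by apply: filterS (as_us Hphi) => i us; exact: us_cexp pH. Qed.

(** The image of the word and the product of the images of its letters are both L^2-close to the
    word itself. Their difference lies in the algebra of [x], where [as_small] applies although the
    word need not lie there. *)
Lemma transfer_word l (k e : R) : 0 < k -> 4 ^+ (size l).+2 * k <= e ->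
  cvar H (pword T y l) <= k -> (forall a, a \in l -> cvar H (letter T y a) <= k) ->
  \forall i \near F,
    msq (phi i (cexp H (pword T y l)) - \prod_(a <- l) phi i (cexp H (letter T y a))) <= e.
Proof.
move=> k0 ke wk lk; have l1 := letter_unit T y1.
pose P := \prod_(a <- l) cexp H (letter T y a).
have kl : k <= 4 ^+ size l * k by rewrite ler_peMl ?(ltW k0)// exprn_ege1// ler1n.
have e0 : 0 < e by apply: lt_le_trans ke; rewrite mulr_gt0// exprn_gt0.
(* Both distances to the word are at most [K = 4 ^ size l * k], and [16 K <= e], so this is at most
   [4 K <= e / 4]. The final count is [2 (e / 3) + 2 (e / 6) = e]. *)
have EP : Exp ((cexp H (pword T y l) - P) ^+ 2) < e / 3.
  apply: (le_lt_trans (Exp_sqr_tri (pword T y l) _ _)).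
  have h1 := le_trans (cexp_dist pH (pword T y l)) wk.
  have h2 : Exp ((pword T y l - P) ^+ 2) <= 4 ^+ size l * k.
    apply: Exp_prod_dist; [exact: ltW|exact: l1|by move=> a; exact: cexp_unitball|].
    by move=> a al; apply: le_trans (cexp_dist pH _) (lk a al).
  have : 4 * (4 * (4 ^+ size l * k)) <= e by rewrite mulrA mulrA -expr2 -exprD.
  rewrite Exp_sqrBC.
  move: (4 ^+ size l * k) kl h2 => K kl h2; lra.
have wP : walg T x (cexp H (pword T y l) - P).
  by apply: saB => //; [exact: cexp_in|apply: sa_prod => // a _; exact: cexp_in].
have e6 : 0 < e / 6 by rewrite divr_gt0.
have aP := as_prod Hphi l (fun a => cexp_in sA pH (letter T y a)) e6.
apply: filterS3 (as_us Hphi) (as_small Hphi wP EP) (aP FF) => i us u v.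
apply: (le_trans (msq_tri _ (phi i P) _)); rewrite -(usB us).
move: u v; rewrite /P; lra.
Qed.

Lemma transfer_mean l (e : R) : 0 < e -> \forall i \near F,
  `|meanv (phi i (cexp H (pword T y l))) - Exp (pword T y l)| <= e.
Proof. by rewrite -(Exp_cexp pH) => e0; apply: (as_exp Hphi) => //; exact: cexp_in. Qed.

(** [H] is not invariant, so [cexp H] does not commute with [T s]; but both orders of composition
    end up near [T s (y n)], the second because [T s] preserves [Exp]. *)
Lemma transfer_shift s n (e : R) : 0 < e -> cvar H (T s (y n)) <= e / 16 ->
  cvar H (y n) <= e / 16 -> \forall i \near F,
    msq (phi i (cexp H (T s (y n))) - shiftv (sigma i s) (phi i (cexp H (y n)))) <= e.
Proof.
move=> e0 k1 k2.
have wS : walg T x (cexp H (T s (y n)) - T s (cexp H (y n))).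
  by apply: saB => //; [exact: cexp_in|apply: walg_pact; exact: cexp_in].
have ES : Exp ((cexp H (T s (y n)) - T s (cexp H (y n))) ^+ 2) < e / 3.
  apply: (le_lt_trans (Exp_sqr_tri (T s (y n)) _ _)).
  rewrite Exp_sqrBC -rmorphB -rmorphXn pact_Exp.
  have := cexp_dist pH (y n); have := cexp_dist pH (T s (y n)); lra.
have e6 : 0 < e / 6 by rewrite divr_gt0.
have aS := as_equi Hphi Hsofic s (cexp_in sA pH (y n)) e6.
apply: filterS3 (as_us Hphi) (as_small Hphi wS ES) (aS FF) => i us u v.
apply: (le_trans (msq_tri _ (phi i (T s (cexp H (y n)))) _)); rewrite -(usB us).
move: u v; lra.
Qed.

Lemma transfer_base f (e : R) : walg T x f -> cvar H f < e ->
  \forall i \near F, msq (phi i f - phi i (cexp H f)) <= e.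
Proof.
move=> wf fe.
have w : walg T x (f - cexp H f) by apply: saB => //; exact: cexp_in.
apply: filterS2 (as_us Hphi) (as_small Hphi w (le_lt_trans (cexp_dist pH f) fe)).
by move=> i us; rewrite (usB us).
Qed.

Lemma transfer_close f g (e : R) : 4 * Exp ((f - g) ^+ 2) < e ->
  \forall i \near F, msq (phi i (cexp H f) - phi i (cexp H g)) <= e.
Proof.
move=> fge; apply: filterS2 (as_us Hphi)
  (as_small Hphi (cexp_in sA pH (f - g)) (le_lt_trans (Exp_cexp_sqr _) fge)).
by move=> i us; rewrite cexpB (usB us).
Qed.

End Transfer.

(** * The real part of the essentially bounded functions *)

Section RealLinfty.
Context (disp : measure_display) (X : measurableType disp) (R : realType).
Variable mu : probability X R.

Definition bfun_pred : {pred X -> R} :=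
  mem [set f : X -> R | measurable_fun [set: X] f /\
    exists M : R, \forall x \ae mu, `|f x| <= M].

(** Functions and not classes: almost everywhere equality is seen only through the cone and the
    integral, which ignore null sets. *)
Record bfun := MkBfun { bfun_fun :> X -> R; bfun_funP : bfun_fun \in bfun_pred }.

HB.instance Definition _ := [isSub for bfun_fun].
HB.instance Definition _ := [Choice of bfun by <:].

Lemma bfun_predP (f : X -> R) : reflect
  (measurable_fun [set: X] f /\ exists M : R, \forall x \ae mu, `|f x| <= M)
  (f \in bfun_pred).
Proof. by apply: (iffP idP) => [/set_mem//|?]; apply/mem_set. Qed.

Lemma bfun_cst (c : R) : cst c \in bfun_pred.
Proof.
apply/bfun_predP; split; first exact: measurable_cst.
by exists `|c|; apply: nearW => x.
Qed.

Lemma bfun_mulr2_closed : {in bfun_pred &, forall f g, f * g \in bfun_pred}.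
Proof.
move=> f g /bfun_predP[mf [M fM]] /bfun_predP[mg [N gN]].
apply/bfun_predP; split; first exact: measurable_funM.
exists (M * N); move: fM gN; apply: filterS2 => x fM gN.
by rewrite fctE normrM ler_pM.
Qed.

Lemma bfun_subring_closed : subring_closed bfun_pred.
Proof.
split; [exact: bfun_cst| |exact: bfun_mulr2_closed].
move=> f g /bfun_predP[mf [M fM]] /bfun_predP[mg [N gN]].
apply/bfun_predP; split; first exact: measurable_funB.
exists (M + N); move: fM gN; apply: filterS2 => x fM gN.
by rewrite fctE (le_trans (ler_normB _ _))// lerD.
Qed.

HB.instance Definition _ :=
  GRing.isSubringClosed.Build (X -> R) bfun_pred bfun_subring_closed.
HB.instance Definition _ :=
  GRing.SubChoice_isSubComPzRing.Build _ _ bfun bfun_subring_closed.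

Lemma bfunP (f g : bfun) : (forall x, f x = g x) -> f = g.
Proof. by move=> fg; apply/val_inj/funext. Qed.

Definition cstb (c : R) : bfun := MkBfun (bfun_cst c).

Lemma cstb_is_zmod_morphism : zmod_morphism cstb.
Proof. by move=> b c; apply: bfunP. Qed.

Lemma cstb_is_monoid_morphism : monoid_morphism cstb.
Proof. by split=> [|b c]; apply: bfunP. Qed.

HB.instance Definition _ :=
  GRing.isZmodMorphism.Build R bfun cstb cstb_is_zmod_morphism.
HB.instance Definition _ :=
  GRing.isMonoidMorphism.Build R bfun cstb cstb_is_monoid_morphism.

Lemma bfun_mfun (f : bfun) : measurable_fun [set: X] f.
Proof. by case: (bfun_predP _ (bfun_funP f)). Qed.

Lemma bfun_bound (f : bfun) :
  exists2 M, 0 < M & \forall x \ae mu, `|f x| <= M.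
Proof.
case: (bfun_predP _ (bfun_funP f)) => _ [M fM].
exists (`|M| + 1); first by rewrite ltr_wpDl.
apply: filterS fM => x /le_trans; apply.
by rewrite (le_trans (ler_norm _))// lerDl.
Qed.

Definition bnneg (f : bfun) : Prop := \forall x \ae mu, 0 <= f x.

Definition bint (f : bfun) : R := \int[mu]_(x in [set: X]) f x.

Lemma ae_bounded_integrable (f : X -> R) M : measurable_fun [set: X] f ->
  (\forall x \ae mu, `|f x| <= M) -> mu.-integrable [set: X] (EFin \o f).
Proof.
move=> mf fM; apply/integrableP; split; first exact/measurable_EFinP.
apply: (@le_lt_trans _ _ (\int[mu]_(x in [set: X]) `|M|%:E)%E); last first.
  by rewrite integral_cst//= probability_setT mule1 ltry.
apply: ae_ge0_le_integral => //.
- by apply: measurableT_comp => //; exact/measurable_EFinP.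
- apply: filterS fM => x fM _ /=.
  by rewrite lee_fin (le_trans fM)// ler_norm.
Qed.

Lemma bfun_integrable (f : bfun) : mu.-integrable [set: X] (EFin \o f).
Proof.
have [M _ fM] := bfun_bound f.
exact: ae_bounded_integrable (bfun_mfun f) fM.
Qed.

Lemma bintD f g : bint (f + g) = bint f + bint g.
Proof. by rewrite /bint -RintegralD//; exact: bfun_integrable. Qed.

Lemma bintZ c f : bint (cstb c * f) = c * bint f.
Proof. by rewrite /bint -RintegralZl//; exact: bfun_integrable. Qed.

Lemma bint1 : bint 1 = 1.
Proof. by rewrite /bint Rintegral_cst//= probability_setT mulr1. Qed.

Lemma bint_ge0 f : bnneg f -> 0 <= bint f.
Proof.
move=> f0; suff -> : bint f = \int[mu]_(x in [set: X]) `|f x|.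
  by apply: Rintegral_ge0 => x _; exact: normr_ge0.
rewrite /bint /Rintegral; congr fine; apply: ae_eq_integral => //.
- by apply/measurable_EFinP; exact: bfun_mfun.
- by apply/measurable_EFinP/measurableT_comp => //; exact: bfun_mfun.
- by apply: filterS f0 => x /ger0_norm ->.
Qed.

Lemma bnnegD f g : bnneg f -> bnneg g -> bnneg (f + g).
Proof. by apply: filterS2 => x; exact: addr_ge0. Qed.

Lemma bnnegM f g : bnneg f -> bnneg g -> bnneg (f * g).
Proof. by apply: filterS2 => x; exact: mulr_ge0. Qed.

Lemma bnneg_sqr f : bnneg (f ^+ 2).
Proof. by apply: nearW => x; exact: sqr_ge0. Qed.

Lemma bnneg_cst c : 0 <= c -> bnneg (cstb c).
Proof. by move=> c0; exact: nearW. Qed.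

Lemma bfun_bounded f : exists2 M, 0 < M & bnneg (cstb M - f) /\ bnneg (cstb M + f).
Proof.
have [M M0 fM] := bfun_bound f; exists M => //.
split; apply: filterS fM => x; rewrite ler_norml => /andP[a b].
  by rewrite subr_ge0.
by rewrite addrC -lerBlDr sub0r.
Qed.

Definition bfun_palg : palg R := Palg bnnegD bnnegM bnneg_sqr bnneg_cst
  bfun_bounded bintD bintZ bint1 bint_ge0.

End RealLinfty.

Section RealKoopman.
Context (G : groupType) (disp : measure_display) (X : measurableType disp)
  (R : realType) (mu : probability X R) (a : pmp_action G mu).

Lemma bkoopman_subproof s (f : bfun mu) : (fun x => f (a s^-1%g x)) \in bfun_pred mu.
Proof.
have /bfun_predP[mf [M fM]] := bfun_funP f.
apply/bfun_predP; split; last by exists M; exact: (ae_act a s^-1%g fM).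
exact: (measurableT_comp mf (measurable_act a _)).
Qed.

Definition bkoopman s (f : bfun_palg mu) : bfun_palg mu := MkBfun (bkoopman_subproof s f).

Lemma bkoopman_is_zmod_morphism s : zmod_morphism (bkoopman s).
Proof. by move=> f g; apply: bfunP. Qed.

Lemma bkoopman_is_monoid_morphism s : monoid_morphism (bkoopman s).
Proof. by split=> [|f g]; apply: bfunP. Qed.

HB.instance Definition _ s := GRing.isZmodMorphism.Build (bfun_palg mu)
  (bfun_palg mu) (bkoopman s) (bkoopman_is_zmod_morphism s).
HB.instance Definition _ s := GRing.isMonoidMorphism.Build (bfun_palg mu)
  (bfun_palg mu) (bkoopman s) (bkoopman_is_monoid_morphism s).

Lemma bkoopman_cst s c : bkoopman s c%:B = c%:B.
Proof. exact: bfunP. Qed.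

Lemma bkoopman_nneg s (f : bfun_palg mu) : nneg f -> nneg (bkoopman s f).
Proof. by move=> f0; exact: (ae_act a s^-1%g f0). Qed.

Lemma bkoopman_Exp s (f : bfun_palg mu) : Exp (bkoopman s f) = Exp f.
Proof.
rewrite /Exp/= /bint /Rintegral; congr fine.
have mT : measurable_fun [set: X] (a s^-1%g) by exact: measurable_act.
have mf : measurable_fun [set: X] (EFin \o f).
  by apply/measurable_EFinP; exact: bfun_mfun.
rewrite -[LHS]/(\int[mu]_(x in a s^-1%g @^-1` [set: X]) ((EFin \o f) \o a s^-1%g) x)%E.
rewrite -(integral_pushforward mT) //.
  apply: eq_measure_integral => A mA _; rewrite /= /pushforward; exact: act_preserving.
exact: (bfun_integrable (bkoopman s f)).
Qed.

Lemma bkoopman1 (f : bfun_palg mu) : bkoopman 1%g f = f.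
Proof. by apply: bfunP => x; rewrite /bkoopman/= invg1 act1. Qed.

Lemma bkoopmanM s t (f : bfun_palg mu) : bkoopman (s * t)%g f = bkoopman s (bkoopman t f).
Proof. by apply: bfunP => x; rewrite /bkoopman/= invgM actM. Qed.

Definition bact : paction G (bfun_palg mu) :=
  @Paction _ _ _ (fun s => bkoopman s : {rmorphism _ -> _})
    bkoopman_cst bkoopman_nneg bkoopman_Exp bkoopman1 bkoopmanM.

End RealKoopman.

(** * Density of words *)

Section L1Limit.
Context (disp : measure_display) (X : measurableType disp) (R : realType).
Variable mu : probability X R.

Lemma bint_EFin (f : bfun mu) : (\int[mu]_(x in [set: X]) (f x)%:E = (bint f)%:E)%E.
Proof.
by rewrite /bint /Rintegral fineK//; apply: integrable_fin_num => //; exact: bfun_integrable.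
Qed.

Lemma summable_increments_cvg (u : nat -> R) :
  (\sum_(0 <= n <oo) `|(u n.+1 - u n)%:E| < +oo)%E -> cvgn u.
Proof.
move=> G_fin; set G := (X in (X < _)%E) in G_fin.
have G0 : (0 <= G)%E by apply: nneseries_ge0 => n _ _; exact: abse_ge0.
have partial n : series (fun k => `|u k.+1 - u k|) n <= fine G.
  rewrite -lee_fin fineK; last by rewrite ge0_fin_numE.
  apply: le_trans (nneseries_lim_ge n _); last by move=> *; exact: abse_ge0.
  by rewrite /series /= sumEFin.
have cN : cvgn (series (fun k => `|u k.+1 - u k|)).
  apply: nondecreasing_is_cvgn.
    by apply: nondecreasing_series => k _ _; exact: normr_ge0.
  by exists (fine G) => _ [n _ <-]; exact: partial.
have c1 : cvgn (series (telescope u)) by exact: normed_cvg.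
rewrite (_ : u = (fun n => u 0%N + series (telescope u) n)).
  by apply: is_cvgD => //; exact: is_cvg_cst.
by apply/funext => n; rewrite -eq_sum_telescope.
Qed.

(* Completeness of [L^1], tested against bounded functions. *)
Lemma L1_limit (w : nat -> bfun mu) :
  (forall n, (\int[mu]_(x in [set: X]) `|(w n.+1 x - w n x)%:E|
                <= (1 / (2 ^ n.+1)%:R)%:E)%E) ->
  exists2 u : X -> R, mu.-integrable [set: X] (EFin \o u) &
    forall b : bfun mu,
      bint (w n * b) @[n --> \oo] --> \int[mu]_(x in [set: X]) (u x * b x).
Proof.
move=> wn.
have mw n : measurable_fun [set: X] (EFin \o w n).
  by apply/measurable_EFinP; exact: bfun_mfun.
pose g n x : \bar R := `|(w n.+1 x - w n x)%:E|%E.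
have mg n : measurable_fun [set: X] (g n).
  apply: measurableT_comp => //; apply/measurable_EFinP.
  by apply: measurable_funB; exact: bfun_mfun.
have g0 n x : (0 <= g n x)%E by exact: abse_ge0.
pose S x : \bar R := (\sum_(0 <= n <oo) g n x)%E.
have S0 x : (0 <= S x)%E by apply: nneseries_ge0.
have mS : measurable_fun [set: X] S.
  by apply: (@ge0_emeasurable_sum _ _ _ _ g xpredT).
have iS : mu.-integrable [set: X] S.
  apply/integrableP; split=> //; under eq_integral do rewrite gee0_abs//.
  rewrite integral_nneseries//; apply: (@le_lt_trans _ _ 1%:E); last exact: ltry.
  apply: le_trans (epsilon_trick0 xpredT ler01).
  by apply: lee_nneseries => [n _ _|n _]; [exact: integral_ge0|exact: wn].
(* The upper limit is measurable on the whole space, and it is the limit wherever [S] is finite. *)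
pose u x := fine (limn_esup (fun n => (w n x)%:E)).
have mu_ : measurable_fun [set: X] (EFin \o u).
  apply/measurable_EFinP; apply: (measurableT_comp (fine_measurable _)) => //.
  exact: measurable_fun_limn_esup.
have wu : \forall x \ae mu, [set: X] x -> ((w n x)%:E @[n --> \oo] --> (u x)%:E)%E.
  apply: filterS (integrable_ae measurableT iS) => x /(_ I) Sx _.
  have /cvg_ex[/= l wl] : cvgn (fun n => w n x).
    by apply: summable_increments_cvg; move: Sx; rewrite ge0_fin_numE.
  have wlE : ((w n x)%:E @[n --> \oo] --> l%:E)%E by exact/cvg_EFin/wl/nearW.
  by rewrite /u (cvg_limn_einf_sup wlE).2.
pose D x : \bar R := (`|(w 0%N x)%:E| + S x)%E.
have iD : mu.-integrable [set: X] D.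
  by apply: integrableD => //; apply: integrable_abse; exact: bfun_integrable.
have wD : \forall x \ae mu, forall n, [set: X] x -> (`|(w n x)%:E| <= D x)%E.
  apply: nearW => x n _; rewrite /D.
  apply: (@le_trans _ _ (`|(w 0%N x)%:E| + \sum_(0 <= k < n) g k x)%E); last first.
    by rewrite leeD2l//; exact: nneseries_lim_ge.
  elim: n => [|n IH]; first by rewrite big_nil adde0.
  rewrite big_nat_recr//= addeA.
  apply: le_trans (leeD IH (lexx _)); rewrite /g -EFinD lee_fin.
  by rewrite -{1}(subrK (w n x) (w n.+1 x)) addrC ler_normD.
have [iu cv _] := dominated_convergence measurableT mw mu_ wu iD wD.
exists u => // b; have [M M0 bM] := bfun_bound b.
have mur : measurable_fun [set: X] u by exact/measurable_EFinP.
have mb := bfun_mfun b.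
have mub : measurable_fun [set: X] (fun x => (u x * b x)%:E).
  by apply/measurable_EFinP; exact: measurable_funM.
have dom (v : X -> R) : measurable_fun [set: X] v ->
    (\int[mu]_(x in [set: X]) `|(v x * b x)%:E|
     <= M%:E * \int[mu]_(x in [set: X]) `|(v x)%:E|)%E.
  move=> mv; rewrite -ge0_integralZl_EFin//; last 2 first.
  - by apply: measurableT_comp => //; exact/measurable_EFinP.
  - exact: ltW.
  apply: ae_ge0_le_integral => //.
  - by apply: measurableT_comp => //; apply/measurable_EFinP; exact: measurable_funM.
  - by move=> x _; rewrite mule_ge0// lee_fin ltW.
  - apply: measurable_funeM; apply: measurableT_comp => //; exact/measurable_EFinP.
  - apply: filterS bM => x bM _; rewrite -EFinM lee_fin normrM mulrC.
    by rewrite ler_wpM2r.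
have iub : mu.-integrable [set: X] (fun x => (u x * b x)%:E).
  apply/integrableP; split=> //; apply: le_lt_trans (dom u mur) _.
  move/integrableP : iu => [_ iu].
  by rewrite lte_mul_pinfty// lee_fin ltW.
apply/cvgrPdist_le => e e0.
have [/= fin0 cv0] := (fine_cvgP _ _).1 cv.
have eM : 0 < e / M by rewrite divr_gt0.
apply: filterS2 fin0 (cvgr0_norm_lt _ cv0 _ eM) => n fn /ltW hn.
have mwu : measurable_fun [set: X] (fun x => w n x - u x).
  by apply: measurable_funB => //; exact: bfun_mfun.
have iwb := bfun_integrable (w n * b).
rewrite distrC /bint -RintegralB//.
rewrite -lee_fin EFin_normr_Rintegral//; last first.
  by apply: (integrableB measurableT iwb iub).
apply: (le_trans (le_abse_integral _ _ _)) => //.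
  apply/measurable_EFinP; apply: measurable_funB; first exact: bfun_mfun.
  exact: measurable_funM.
apply: (@le_trans _ _ (M%:E * \int[mu]_(x in [set: X]) `|(w n x - u x)%:E|)%E).
  apply: le_trans (dom _ mwu); rewrite le_eqVlt; apply/orP; left; apply/eqP.
  by apply: eq_integral => x _; rewrite mulrBl.
rewrite -lee_pdivlMl// -EFinM [_^-1 * _]mulrC; move: hn; rewrite ger0_norm.
  by rewrite -lee_fin fineK.
by rewrite fine_ge0// integral_ge0.
Qed.

End L1Limit.

(** * Orthogonal projection without completeness *)

Section NearMinimizers.
Context (R : realType) (B : palg R).
Implicit Types f g h : B.

Lemma quadratic_discriminant (u v w : R) : 0 <= w ->
  (forall t, 0 <= u + 2 * t * v + t ^+ 2 * w) -> v ^+ 2 <= u * w.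
Proof.
rewrite le_eqVlt => /predU1P[w0|w0] E2.
  rewrite -w0 mulr0; have [->|v0] := eqVneq v 0; first by rewrite expr0n.
  (* For [w = 0] the polynomial is affine, and at this [t] its value would be -1. *)
  have := E2 (- (u + 1) / (2 * v)).
  rewrite -w0 mulr0 addr0 [X in _ + X](_ : _ = - (u + 1)); last by field.
  by rewrite opprD addrA subrr sub0r ler0N1.
have := E2 (- v / w).
rewrite (_ : _ + _ = (u * w - v ^+ 2) / w); last by field; rewrite gt_eqF.
by rewrite pmulr_lge0 ?invr_gt0// subr_ge0.
Qed.

Variable K : B -> Prop.
Hypotheses (K0 : K 0) (KD : forall f g, K f -> K g -> K (f + g))
  (KZ : forall c f, K f -> K (c%:B * f)).

(** The projection theorem with the limit left out: the minimizing sequence is Cauchy and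
    asymptotically orthogonal to [K], with explicit rates. The uniform bound on second moments makes
    the orthogonality applicable to the moving vector [h n]. *)
Lemma near_minimizers f : exists h : nat -> B, [/\ forall n, K (h n),
  forall n, Exp ((f - h n.+1 - (f - h n)) ^+ 2) <= (4^-1) ^+ n.+1,
  forall n g, K g -> `|Exp ((f - h n) * g)| <= 2^-1 ^+ n * (Exp (g ^+ 2) + 1)
  & exists C, forall n, Exp (h n ^+ 2) <= C].
Proof.
pose S := [set Exp ((f - h) ^+ 2) | h in K].
have infS : has_inf S.
  split; first by exists (Exp ((f - 0) ^+ 2)), 0.
  by exists 0 => _ [h _ <-]; exact/Exp_ge0/nneg_sqr.
have Sinf h : K h -> inf S <= Exp ((f - h) ^+ 2).
  by move=> Kh; apply: (ge_inf infS.2); exists h.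
have e0 n : 0 < (4^-1 : R) ^+ n by rewrite exprn_gt0// invr_gt0.
have e4 n : (4^-1 : R) ^+ n.+2 <= 4^-1 ^+ n.
  by have := e0 n; rewrite !exprS; move: (4^-1 ^+ n) => b; lra.
have /choice[h hP] n : exists h, K h /\ Exp ((f - h) ^+ 2) < inf S + 4^-1 ^+ n.+2.
  by have [_ [h Kh <-] hS] := inf_adherent (e0 n.+2) infS; exists h.
exists h; split.
- by move=> n; case: (hP n).
- move=> n; have [Kn hn] := hP n; have [Kn1 hn1] := hP n.+1.
  (* Parallelogram law: the midpoint is in [K], hence no closer to [f] than [inf S]. The slacks at
     [n] and [n.+1] contribute [2 / 4 ^ (n + 2) + 2 / 4 ^ (n + 3)], below [1 / 4 ^ (n + 1)]. *)
  have := Sinf _ (KZ 2^-1 (KD Kn Kn1)).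
  have two : 2^-1%:B * 2 = 1 :> B by rewrite -(rmorph_nat (pa_cst B)) -cstBM mulVf ?cstB1.
  have -> : f - 2^-1%:B * (h n + h n.+1) = 2^-1%:B * ((f - h n) + (f - h n.+1)).
    by rewrite -{1}[f]mul1r -two; ring.
  rewrite exprMn -rmorphXn ExpZ => le.
  have -> : (f - h n.+1 - (f - h n)) ^+ 2 = 2%:B * (f - h n) ^+ 2 +
      2%:B * (f - h n.+1) ^+ 2 - ((f - h n) + (f - h n.+1)) ^+ 2 by ring.
  rewrite ExpB ExpD !ExpZ.
  move: hn hn1 le; rewrite ![4^-1 ^+ _.+1]exprS -[2^-1 ^+ 2]/(2^-1 * 2^-1).
  have := e0 n; move: (4^-1 ^+ n) (Exp _) (Exp _) (Exp _) (inf S) => a b c p q; lra.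
- move=> n g Kg; have [Kn hn] := hP n.
  (* First variation: moving from [h n] along [g] stays in [K], so the distance, a quadratic in [t],
     never drops below [inf S]. Afterwards [Exp (g ^+ 2) + 1] replaces the square root of
     [Exp (g ^+ 2)]. *)
  have sq : Exp ((f - h n) * g) ^+ 2 <= 4^-1 ^+ n * Exp (g ^+ 2).
    apply: quadratic_discriminant => [|t]; first exact/Exp_ge0/nneg_sqr.
    have := Sinf _ (KD Kn (KZ (- t) Kg)).
    have -> : (f - (h n + (- t)%:B * g)) ^+ 2 = (f - h n) ^+ 2 +
       (2 * t)%:B * ((f - h n) * g) + (t ^+ 2)%:B * g ^+ 2 by ring.
    have := e4 n; rewrite !ExpD !ExpZ; lra.
  have g0 : 0 <= Exp (g ^+ 2) by exact/Exp_ge0/nneg_sqr.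
  rewrite -(@ler_pXn2r _ 2)// ?nnegrE// ?mulr_ge0 ?addr_ge0 ?exprn_ge0 ?invr_ge0//.
  rewrite real_normK ?num_real// exprMn -exprM mulnC exprM.
  have -> : (2^-1 : R) ^+ 2 = 4^-1 by rewrite exprVn -natrX.
  apply: (le_trans sq).
  rewrite ler_wpM2l ?(ltW (e0 n))//; move: (Exp _) g0 => c c0.
  by rewrite -subr_ge0 (_ : _ - _ = c ^+ 2 + c + 1); [rewrite !addr_ge0 ?sqr_ge0|ring].
- exists (2 * (inf S + 1) + 2 * Exp (f ^+ 2)) => n; have [Kn hn] := hP n.
  have tri := Exp_sqr_tri f (h n) 0; rewrite (Exp_sqrBC (h n) f) !subr0 in tri.
  apply: (le_trans tri).
  have : (4^-1 : R) ^+ n.+2 <= 1 by rewrite exprn_ile1// ?invr_ge0// invf_le1// ler1n.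
  lra.
Qed.

End NearMinimizers.

Section WeakClosure.
Context (disp : measure_display) (X : measurableType disp) (R : realType).
Variable mu : probability X R.
Implicit Types f g h : bfun_palg mu.

(** L^1 against L^2 through the pointwise bound [|f| <= f^2 / (2 c) + c / 2]. *)
Lemma integral_norm_le_sqr f (c : R) : 0 < c -> Exp (f ^+ 2) <= c ^+ 2 ->
  (\int[mu]_(x in [set: X]) `|(f x)%:E| <= c%:E)%E.
Proof.
move=> c0 fc; pose g := (2 * c)^-1%:B * f ^+ 2 + (c / 2)%:B * 1.
have gE x : g x = (2 * c)^-1 * f x ^+ 2 + c / 2 * 1 by [].
apply: (@le_trans _ _ (\int[mu]_(x in [set: X]) (g x)%:E)%E).
  apply: ge0_le_integral => //.
  - by apply: measurableT_comp => //; apply/measurable_EFinP; exact: bfun_mfun.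
  - by apply/measurable_EFinP; exact: (bfun_mfun g).
  - move=> x _; rewrite lee_fin gE -subr_ge0 -real_normK ?num_real//.
    rewrite (_ : _ - _ = (2 * c)^-1 * (`|f x| - c) ^+ 2); last first.
      by field; rewrite gt_eqF.
    by rewrite mulr_ge0 ?sqr_ge0// invr_ge0 mulr_ge0// ltW.
rewrite (bint_EFin (g : bfun mu)) lee_fin.
have -> : bint (g : bfun mu) = (2 * c)^-1 * Exp (f ^+ 2) + c / 2.
  by rewrite -[bint _]/(Exp g) ExpD !ExpZ Exp1 mulr1.
have : (2 * c)^-1 * Exp (f ^+ 2) <= (2 * c)^-1 * c ^+ 2.
  by rewrite ler_wpM2l// invr_ge0 mulr_ge0// ltW.
rewrite (_ : (2 * c)^-1 * c ^+ 2 = c / 2); last by field; rewrite gt_eqF.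
by move=> h; apply: (le_trans (lerD h (lexx _))); rewrite -splitr.
Qed.

Variable K : bfun_palg mu -> Prop.
Hypotheses (K0 : K 0) (KD : forall f g, K f -> K g -> K (f + g))
  (KZ : forall c f, K f -> K (c%:B * f)).
Hypothesis K_closed : forall f,
  (forall k : R, 0 < k -> exists2 g, K g & Exp ((f - g) ^+ 2) <= k) -> K f.

(* The limit [u] of [f - h n], where [h] minimizes the distance from [f] to [K],
   is orthogonal to [K]. *)
Lemma weak_closed f :
  (forall (u : X -> R) (e : R), mu.-integrable [set: X] (EFin \o u) -> 0 < e ->
    exists2 h, K h & `|\int[mu]_(x in [set: X]) ((f x - h x) * u x)| < e) -> K f.
Proof.
move=> fK; have [h [Kh dh oh [C hC]]] := near_minimizers K0 KD KZ f.
pose w n : bfun mu := f - h n.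
have e0 n : 0 < (2^-1 : R) ^+ n by rewrite exprn_gt0// invr_gt0.
have cvg0 (v : nat -> R) (c : R) : (forall n, `|v n| <= 2^-1 ^+ n * c) -> v n @[n --> \oo] --> 0.
  move=> vc; apply/cvgr0Pnorm_le => e ep.
  have c0 : 0 < `|c| + 1 by rewrite ltr_wpDl.
  have h0 : (fun n => geometric (`|c| + 1) (2^-1 : R) n) @ \oo --> (0 : R).
    by apply: cvg_geometric; rewrite ger0_norm ?invr_ge0// invf_lt1// ltr1n.
  apply: filterS (cvgr0_norm_le _ h0 _ ep) => n; apply: le_trans.
  apply: (le_trans (vc n)); rewrite /= ger0_norm ?mulr_ge0 ?(ltW (e0 n)) ?(ltW c0)//.
  rewrite mulrC ler_wpM2r ?(ltW (e0 n))//.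
  by rewrite (le_trans (ler_norm c))// lerDl.
have [|u iu uP] := @L1_limit _ _ _ mu w.
  move=> n; have c0 := e0 n.+1; rewrite div1r natrX -exprVn.
  apply: (@integral_norm_le_sqr (w n.+1 - w n) _ c0); apply: (le_trans (dh n)).
  by rewrite exprAC (_ : 2^-1 ^+ 2 = 4^-1)// exprVn -natrX.
have wK g : K g -> Exp ((f - h n) * g) @[n --> \oo] --> 0.
  by move=> Kg; apply: (cvg0 _ (Exp (g ^+ 2) + 1)) => n; exact: oh.
have wh : Exp ((f - h n) * h n) @[n --> \oo] --> 0.
  apply: (cvg0 _ (C + 1)) => n; apply: (le_trans (oh n _ (Kh n))).
  by rewrite ler_wpM2l ?(ltW (e0 n))// lerD.
(* The limit is the integral of [u f]. As [u] annihilates [K], it equals the integral of [u (f - g)]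
   for every [g] in [K], and [fK] with the test function [u] makes that arbitrarily small. *)
have wf : Exp ((f - h n) * f) @[n --> \oo] --> 0.
  have uf := uP f.
  suff -> : 0 = \int[mu]_(x in [set: X]) (u x * f x) by [].
  apply/esym/eqP; rewrite -normr_eq0 eq_le normr_ge0 andbT.
  apply/ler_addgt0Pl => e ep; rewrite addr0.
  have [g Kg /ltW] := fK u e iu ep.
  rewrite (_ : \int[mu]_(x in [set: X]) ((f x - g x) * u x) =
    \int[mu]_(x in [set: X]) (u x * f x))//.
  have -> : \int[mu]_(x in [set: X]) ((f x - g x) * u x) =
      \int[mu]_(x in [set: X]) (u x * (f - g : bfun mu) x).
    by apply: eq_Rintegral => x _; rewrite mulrC.
  have ufg := uP (f - g).
  apply: (cvg_unique _ ufg) => //.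
  rewrite (_ : (fun n => bint (w n * (f - g))) =
    (fun n => Exp ((f - h n) * f) - Exp ((f - h n) * g))); last first.
    by apply/funext => n; rewrite -ExpB -mulrBr.
  have c := cvgB uf (wK g Kg); rewrite subr0 in c; exact: c.
apply: K_closed => k k0.
have ww : Exp ((f - h n) ^+ 2) @[n --> \oo] --> 0.
  rewrite (_ : (fun n => _) = (fun n => Exp ((f - h n) * f) - Exp ((f - h n) * h n))).
    have c := cvgB wf wh; rewrite subr0 in c; exact: c.
  by apply/funext => n; rewrite -ExpB -mulrBr.
have [n _ /(_ n (leqnn n)) hn] := cvgr0_norm_le _ ww _ k0.
by exists (h n) => //; apply: le_trans hn; exact: ler_norm.
Qed.

End WeakClosure.

Section RealPart.
Context (disp : measure_display) (X : measurableType disp) (R : realType).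
Variable mu : probability X R.
Local Notation Linfty := (Linfty mu).
Implicit Types f g : Linfty.

Lemma normc_ge_Re (z : R[i]) : `|complex.Re z| <= Normc.normc z.
Proof.
case: z => a b /=; rewrite -[leLHS]sqrtr_sqr ler_wsqrtr// ?lerDl ?sqr_ge0//.
Qed.

Lemma normc_ge_Im (z : R[i]) : `|complex.Im z| <= Normc.normc z.
Proof.
case: z => a b /=; rewrite -[leLHS]sqrtr_sqr ler_wsqrtr// ?lerDr ?sqr_ge0//.
Qed.

Lemma repart_subproof f : (fun x => complex.Re (f x)) \in bfun_pred mu.
Proof.
have /Linfty_predP[[f1 _] [M fM]] := Linfty_funP f.
apply/bfun_predP; split=> //; exists M; apply: filterS fM => x.
exact/le_trans/normc_ge_Re.
Qed.

Lemma impart_subproof f : (fun x => complex.Im (f x)) \in bfun_pred mu.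
Proof.
have /Linfty_predP[[_ f2] [M fM]] := Linfty_funP f.
apply/bfun_predP; split=> //; exists M; apply: filterS fM => x.
exact/le_trans/normc_ge_Im.
Qed.

Definition repart f : bfun_palg mu := MkBfun (repart_subproof f).
Definition impart f : bfun_palg mu := MkBfun (impart_subproof f).

Lemma toLinfty_subproof (f : bfun mu) : (fun x => (f x)%:C%C) \in Linfty_pred mu.
Proof.
have /bfun_predP[mf [M fM]] := bfun_funP f.
apply/Linfty_predP; split; first by split=> //=; exact: measurable_cst.
exists M; apply: filterS fM => x.
by rewrite /= expr0n/= addr0 sqrtr_sqr.
Qed.

Definition toLinfty (f : bfun_palg mu) : Linfty := MkLinfty (toLinfty_subproof f).

Lemma toLinftyK : cancel toLinfty repart.
Proof. by move=> f; apply: bfunP. Qed.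

Lemma Linfty_eq f g : (forall x, f x = g x) -> f = g.
Proof. by move=> fg; apply/val_inj/funext. Qed.

Lemma repartD f g : repart (f + g) = repart f + repart g.
Proof.
apply: bfunP => x; rewrite -[LHS]/(complex.Re (f x + g x)).
rewrite -[RHS]/(complex.Re (f x) + complex.Re (g x)).
by case: (f x) (g x) => ? ? [].
Qed.

Lemma impartD f g : impart (f + g) = impart f + impart g.
Proof.
apply: bfunP => x; rewrite -[LHS]/(complex.Im (f x + g x)).
rewrite -[RHS]/(complex.Im (f x) + complex.Im (g x)).
by case: (f x) (g x) => ? ? [].
Qed.

Lemma repartM f g : repart (f * g) = repart f * repart g - impart f * impart g.
Proof.
apply: bfunP => x; rewrite -[LHS]/(complex.Re (f x * g x)).
rewrite -[RHS]/(complex.Re (f x) * complex.Re (g x) - complex.Im (f x) * complex.Im (g x)).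
by case: (f x) (g x) => ? ? [].
Qed.

Lemma impartM f g : impart (f * g) = repart f * impart g + impart f * repart g.
Proof.
apply: bfunP => x; rewrite -[LHS]/(complex.Im (f x * g x)).
rewrite -[RHS]/(complex.Re (f x) * complex.Im (g x) + complex.Im (f x) * complex.Re (g x)).
by case: (f x) (g x) => ? ? [].
Qed.

Lemma repartZ c f :
  repart (c *: f) = (complex.Re c)%:B * repart f - (complex.Im c)%:B * impart f.
Proof.
apply: bfunP => x; rewrite -[LHS]/(complex.Re (c * f x)).
rewrite -[RHS]/(complex.Re c * complex.Re (f x) - complex.Im c * complex.Im (f x)).
by case: c (f x) => ? ? [].
Qed.

Lemma impartZ c f :
  impart (c *: f) = (complex.Re c)%:B * impart f + (complex.Im c)%:B * repart f.
Proof.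
apply: bfunP => x; rewrite -[LHS]/(complex.Im (c * f x)).
rewrite -[RHS]/(complex.Re c * complex.Im (f x) + complex.Im c * complex.Re (f x)).
by case: c (f x) => ? ? [].
Qed.

Lemma repart1 : repart 1 = 1. Proof. exact: bfunP. Qed.
Lemma impart1 : impart 1 = 0. Proof. exact: bfunP. Qed.

Lemma repart_conj f : repart (Linfty_conj f) = repart f.
Proof. by apply: bfunP => x /=; case: (f x). Qed.

Lemma impart_conj f : impart (Linfty_conj f) = - impart f.
Proof. by apply: bfunP => x; rewrite /= -[RHS]/(- complex.Im (f x)); case: (f x). Qed.

End RealPart.

(** * Density from dynamic generation *)

Section Density.
Context (G : groupType) (disp : measure_display) (X : measurableType disp)
  (R : realType) (mu : probability X R) (a : pmp_action G mu).
Variable p : nat -> Linfty mu.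
Hypothesis hp : forall n, real_unit_ball (p n).
Hypothesis pgen : dynamically_generating a p.

Lemma repart_koopman s (f : Linfty mu) : repart (koopman a s f) = bact a s (repart f).
Proof. exact: bfunP. Qed.

Lemma impart_koopman s (f : Linfty mu) : impart (koopman a s f) = bact a s (impart f).
Proof. exact: bfunP. Qed.

Definition rgen n : bfun_palg mu := repart (p n).

Lemma p_ae n : \forall x \ae mu, p n x = toLinfty (rgen n) x.
Proof.
have [pr _] := hp n; apply: filterS pr => x; rewrite /=; case: (p n x) => u v.
by move=> /complex_realP[r [-> ->]].
Qed.

Lemma rgen_unitball n : unitball (rgen n).
Proof.
have [_] := hp n; rewrite Linfty_normE => /ess_supP h.
by split; apply: filterS h => x /=; rewrite lee_fin => /(le_trans (normc_ge_Re _));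
  rewrite ler_norml => /andP[? ?]; [rewrite subr_ge0|rewrite addrC -lerBlDr sub0r].
Qed.

(** The generators are real only almost everywhere, so their imaginary parts are null functions and
    not 0; this form lets [good_closed] treat them as limits of 0. *)
Lemma impart_gen n (k : R) : 0 < k -> Exp (impart (p n) ^+ 2) <= k.
Proof.
move=> k0; apply: (@le_trans _ _ (Exp (0 : bfun_palg mu))); last by rewrite Exp0 ltW.
apply: Exp_le; apply: filterS (p_ae n) => x px.
change (0 <= 0 - complex.Im (p n x) * complex.Im (p n x)).
by rewrite px /= mulr0 subr0.
Qed.

Let A := walg (bact a) rgen.
Let sA : subalgebra A := walg_subalgebra _ _.

Lemma good_words_closed (f : bfun_palg mu) :
  (forall (u : X -> R) (e : R), mu.-integrable [set: X] (EFin \o u) -> 0 < e ->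
    exists2 h : bfun_palg mu, good A h &
      `|\int[mu]_(x in [set: X]) ((f x - h x) * u x)| < e) -> good A f.
Proof.
apply: weak_closed.
- by apply: good_walg; [exact: rgen_unitball|exact: sa0].
- by move=> g h; exact: (goodD sA).
- by move=> c g; exact: goodZ.
- by move=> g; exact: good_closed.
Qed.

Lemma vN_good : von_neumann_subalgebra
  [set f | good A (repart f) /\ good A (impart f)].
Proof.
have g1 : good A 1 by apply: good_walg; [exact: rgen_unitball|exact: sa1].
have g0 : good A 0 by apply: good_walg; [exact: rgen_unitball|exact: sa0].
split=> /=.
- by rewrite repart1 impart1.
- move=> f g [f1 f2] [h1 h2]; rewrite repartD impartD.
  by split; exact: (goodD sA).
- move=> c f [f1 f2]; rewrite repartZ impartZ.
  split; [apply: (goodB sA)|apply: (goodD sA)]; exact: goodZ.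
- move=> f g [f1 f2] [h1 h2]; rewrite repartM impartM.
  split; [apply: (goodB sA)|apply: (goodD sA)]; exact: (goodM sA).
- by move=> f [f1 f2]; rewrite repart_conj impart_conj; split; [exact: f1|exact: goodN].
- move=> f fN.
  (* Against a real test function, the real and imaginary parts of the integral test the real and
     imaginary parts of [f - h] separately. *)
  have test (u : X -> R) (e : R) : mu.-integrable [set: X] (EFin \o u) -> 0 < e ->
    exists h : Linfty mu, [/\ good A (repart h), good A (impart h) &
     Normc.normc (cintegral mu (fun x => (f x - h x) * (u x)%:C%C)) < e].
    move=> iu e0.
    have [|h [h1 h2] /(_ ord0) he] := fN 1%N (fun _ x => (u x)%:C%C) e _ e0.
      move=> _; split=> //=; exact: integrable0.
    by exists h.
  split; apply: good_words_closed => u e iu e0; have [h [h1 h2 he]] := test u e iu e0.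
    exists (repart h) => //; apply: le_lt_trans he; apply: le_trans (normc_ge_Re _).
    rewrite /cintegral/= le_eqVlt; apply/orP; left; apply/eqP; congr `|_|.
    apply: eq_Rintegral => x _.
    by case: (f x) (h x) => ? ? [? ?] /=; rewrite mulr0 subr0.
  exists (impart h) => //; apply: le_lt_trans he; apply: le_trans (normc_ge_Im _).
  rewrite /cintegral/= le_eqVlt; apply/orP; left; apply/eqP; congr `|_|.
  apply: eq_Rintegral => x _.
  by case: (f x) (h x) => ? ? [? ?] /=; rewrite mulr0 add0r.
Qed.

(** Approximate [f] by an element of [A]: its translate is again in [A], and translation preserves
    L^2 distances. *)
Lemma good_pact s f : good A f -> good A (bact a s f).
Proof.
move=> gf; apply: good_closed => k k0; have [g Ag gk] := goodP sA gf k0.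
exists (bact a s g).
  by apply: good_walg; [exact: rgen_unitball|exact: walg_pact].
by rewrite -rmorphB -rmorphXn pact_Exp.
Qed.

Lemma all_good (f : bfun_palg mu) : good A f.
Proof.
pose N : set (Linfty mu) := [set f | good A (repart f) /\ good A (impart f)].
have Nact s : koopman a s @` N `<=` N.
  move=> _ [g [g1 g2] <-]; split.
    by rewrite repart_koopman; exact: good_pact.
  by rewrite impart_koopman; exact: good_pact.
have Np n : N (p n).
  split.
    rewrite -[repart _]/(rgen n) -[rgen n](pact1 (bact a)).
    exact: (good_letter (bact a) rgen_unitball (1%g, n)).
  apply: good_closed => k k0; exists 0.
    by apply: good_walg; [exact: rgen_unitball|exact: sa0].
  by rewrite subr0; exact: impart_gen.
have NT : N = [set: Linfty mu] := pgen vN_good Nact Np.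
have : N (toLinfty f) by rewrite NT.
by move=> [+ _]; rewrite toLinftyK.
Qed.

End Density.

(** * Approximate homomorphisms and entropy *)

Section Complexification.
Context (R : realType) (d : nat).
Implicit Types x y : 'I_d -> R.

Definition toC x : 'I_d -> R[i] := fun k => (x k)%:C%C.

Lemma toCB x y : toC (x - y) = toC x - toC y.
Proof. by apply/funext => k; rewrite /toC !fctE rmorphB. Qed.

Lemma toC_prod (J : Type) (s : seq J) (P : pred J) (u : J -> 'I_d -> R) :
  toC (\prod_(j <- s | P j) u j) = \prod_(j <- s | P j) toC (u j).
Proof.
elim/big_rec2: _ => [//|j v w _ <-].
by apply/funext => k; rewrite /toC !fctE rmorphM.
Qed.

Lemma norm2_toC x : norm2 (toC x) = Num.sqrt (msq x).
Proof.
rewrite /norm2 /msq /meanv; congr (Num.sqrt (_ * _)); apply: eq_bigr => k _.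
by rewrite /toC /= expr0n/= addr0 sqrtr_sqr real_normK ?num_real.
Qed.

Lemma zeta_toC x : zeta (toC x) = (meanv x)%:C%C.
Proof. by rewrite /zeta /meanv rmorphM rmorph_sum fmorphV rmorph_nat. Qed.

Lemma perm_shift_toC (u : 'S_d) x : perm_shift u (toC x) = toC (shiftv u x).
Proof. by []. Qed.

Lemma sqrt_lt (m e : R) : 0 < e -> (Num.sqrt m < e) = (m < e ^+ 2).
Proof.
move=> e0; rewrite -[X in _ < X = _]ger0_norm ?ltW// -sqrtr_sqr ltr_sqrt//.
by rewrite exprn_gt0.
Qed.

End Complexification.

Section Restriction.
Context (disp : measure_display) (X : measurableType disp) (R : realType).
Variable mu : probability X R.
Context (d : nat).
Local Notation Linfty := (Linfty mu).
Local Notation B := (bfun_palg mu).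

Definition restrictR (phi : Linfty -> 'I_d -> R[i]) : B -> 'I_d -> R :=
  fun f k => complex.Re (phi (toLinfty f) k).

Definition extendC (psi : B -> 'I_d -> R) : Linfty -> 'I_d -> R[i] :=
  fun f k => (psi (repart f) k +i* psi (impart f) k)%C.

Lemma toLinftyD (f g : B) : toLinfty (f + g) = toLinfty f + toLinfty g.
Proof.
apply: Linfty_eq => x.
by change ((f x + g x)%:C%C = (f x)%:C%C + (g x)%:C%C); rewrite rmorphD.
Qed.

Lemma toLinftyZ c (f : B) : toLinfty (c%:B * f) = c%:C%C *: toLinfty f.
Proof.
apply: Linfty_eq => x.
by change ((c * f x)%:C%C = c%:C%C * (f x)%:C%C); rewrite rmorphM.
Qed.

Lemma toLinfty1 : toLinfty (1 : B) = 1.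
Proof. exact: Linfty_eq. Qed.

Section OfComplex.
Variable phi : Linfty -> 'I_d -> R[i].
Hypothesis up : unital_positive phi.

Lemma upD f g k : phi (f + g) k = phi f k + phi g k.
Proof. by have := up_linear up 1 f g; rewrite !scale1r => ->. Qed.

Lemma upZ c f k : phi (c *: f) k = c * phi f k.
Proof.
have phi0 : phi 0 = 0.
  have := up_linear up 1 0 0; rewrite !scale1r addr0 => /eqP.
  by rewrite -subr_eq0 opprD addNKr oppr_eq0 => /eqP.
by have := up_linear up c f 0; rewrite addr0 phi0 addr0 => ->.
Qed.

Lemma restrictR_ustate : ustate (restrictR phi).
Proof.
split.
- move=> f g; apply/funext => k.
  rewrite /restrictR toLinftyD upD !fctE.
  by case: (phi _ k) (phi _ k) => ? ? [].
- move=> c f k; rewrite /restrictR toLinftyZ upZ.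
  by case: (phi _ k) => ? ? /=; rewrite mul0r subr0.
- by move=> k; rewrite /restrictR toLinfty1 (up_unital up).
- move=> f k f0; rewrite /restrictR.
  have : 0 <= phi (toLinfty f) k.
    by apply: (up_positive up); apply: filterS f0 => x f0; rewrite /= lecR.
  by rewrite lecE => /andP[].
Qed.

(** Positivity forces real values on real functions: [M + g] is nonnegative for a large constant
    [M], so its image is real, and constants go to constants. *)
Lemma restrictRE (f : Linfty) (g : B) : (\forall x \ae mu, f x = toLinfty g x) ->
  phi f = toC (restrictR phi g).
Proof.
move=> /(up_ae up) ->; apply/funext => k; rewrite /toC /restrictR.
have [M M0 [g1 g2]] := pa_bounded g.
have : 0 <= phi (toLinfty (M%:B + g)) k.
  by apply: (up_positive up); apply: filterS g2 => x g2; rewrite /= lecR.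
rewrite toLinftyD -[M%:B]mulr1 toLinftyZ toLinfty1 upD upZ (up_unital up) mulr1.
rewrite lecE => /andP[/eqP + _] /=; case: (phi _ k) => u v /=.
by rewrite add0r => ->.
Qed.

End OfComplex.

(** A real state automatically respects almost everywhere equality, since then both differences are
    in the cone; the rest is complex linearity. *)
Lemma extendC_up (psi : B -> 'I_d -> R) : ustate psi -> unital_positive (extendC psi).
Proof.
move=> us.
have us_le (f g : B) k : (\forall x \ae mu, f x = g x) -> psi f k <= psi g k.
  move=> fg; rewrite -subr_ge0 -[X in 0 <= X]/((psi g - psi f) k) -(usB us).
  apply: (us_ge0 us); apply: filterS fg => x fg.
  by change (0 <= g x - f x); rewrite fg subrr.
have us_ae (f g : B) : (\forall x \ae mu, f x = g x) -> psi f = psi g.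
  move=> fg; apply/funext => k; apply/eqP; rewrite eq_le !us_le//.
  by apply: filterS fg => x ->.
split.
- move=> f g fg; apply/funext => k; rewrite /extendC.
  by congr (_ +i* _)%C; apply: (congr1 (@^~ k)); apply: us_ae; apply: filterS fg => x /= ->.
- move=> c f g; apply/funext => k; rewrite /extendC !fctE.
  rewrite repartD impartD repartZ impartZ !(usDk us) (usN us) !(usZ us).
  rewrite -[RHS]/(c * (psi (repart f) k +i* psi (impart f) k)%C +
    (psi (repart g) k +i* psi (impart g) k)%C).
  by case: c => u v /=; apply/eqP; rewrite eq_complex /= !eqxx.
- apply/funext => k; rewrite /extendC repart1 impart1 (us1 us) (us0 us).
  by [].
- move=> f f0 k; rewrite /extendC lecE /=.
  have -> : psi (impart f) = psi 0.
    by apply: us_ae; apply: filterS f0 => x; rewrite lecE /= => /andP[/eqP -> _].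
  rewrite (us0 us) eqxx; apply: (us_ge0 us).
  by apply: filterS f0 => x; rewrite lecE /= => /andP[].
Qed.

Lemma extendCK (psi : B -> 'I_d -> R) : restrictR (extendC psi) = psi.
Proof. by apply/funext => f; apply/funext => k; rewrite /restrictR /extendC toLinftyK. Qed.

End Restriction.

Section RealUP.
Context (G : groupType) (disp : measure_display) (X : measurableType disp)
  (R : realType) (mu : probability X R) (a : pmp_action G mu).
Variable p : nat -> Linfty mu.
Hypothesis hp : forall n, real_unit_ball (p n).
Local Notation T := (bact a).
Local Notation x := (rgen p).

Lemma koopman_ae s n :
  \forall t \ae mu, koopman a s (p n) t = toLinfty (letter T x (s, n)) t.
Proof. exact: (ae_act a s^-1%g (p_ae hp n)). Qed.

Lemma word_ae j (s : 'I_j -> G) (n : 'I_j -> nat) :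
  \forall t \ae mu, word a p s n t = toLinfty (\prod_(i < j) letter T x (s i, n i)) t.
Proof.
rewrite /word; elim/big_ind2: _ => [|f' f g' g ff gg|i _]; last exact: koopman_ae.
  by apply: nearW => t; rewrite toLinfty1.
move: ff gg; apply: filterS2 => t ft gt.
change (f t * g t = (f' t * g' t)%:C%C); rewrite ft gt.
by rewrite [RHS]rmorphM.
Qed.

Lemma cintegral_ae (f : Linfty mu) (g : bfun_palg mu) :
  (\forall t \ae mu, f t = toLinfty g t) -> cintegral mu f = (Exp g)%:C%C.
Proof.
move=> fg; rewrite /cintegral -[RHS]/((Exp g) +i* 0)%C; congr (_ +i* _)%C.
  have -> : \int[mu]_(t in [set: X]) complex.Re (f t) = Exp (repart f) by [].
  apply/eqP; rewrite eq_le !Exp_le//; apply: filterS fg => t ft.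
    by change (0 <= complex.Re (f t) - g t); rewrite ft subrr.
  by change (0 <= g t - complex.Re (f t)); rewrite ft subrr.
have -> : \int[mu]_(t in [set: X]) complex.Im (f t) = Exp (impart f) by [].
rewrite -(Exp0 (bfun_palg mu)).
apply/eqP; rewrite eq_le !Exp_le//; apply: filterS fg => t ft.
  by change (0 <= complex.Im (f t) - 0); rewrite ft subrr.
by change (0 <= 0 - complex.Im (f t)); rewrite ft subrr.
Qed.

Variables (d : nat) (sigma : G -> 'S_d).

(** Words as lists can be concatenated and enumerated, unlike pairs of functions on ['I_j] with
    varying [j]. *)
Definition admissible_seq (F : set G) (m : nat) (l : seq (G * nat)) : Prop :=
  (1 <= size l <= m)%N /\ forall b, b \in l -> F b.1 /\ (b.2 < m)%N.

Section OfUP.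
Variables (F : set G) (m : nat) (delta : R) (phi : Linfty mu -> 'I_d -> R[i]).
Hypotheses (d0 : 0 < delta) (UPphi : UP a p F m delta sigma phi).
Let up : unital_positive phi. Proof. by case: UPphi. Qed.

Let adm l : admissible_seq F m l ->
  admissible F m (fun i => (tnth (in_tuple l) i).1) (fun i => (tnth (in_tuple l) i).2).
Proof. by move=> [sl lF]; split=> // i; case: (lF _ (mem_tnth i (in_tuple l))). Qed.

Let wordE l : phi (word a p (fun i => (tnth (in_tuple l) i).1)
                            (fun i => (tnth (in_tuple l) i).2)) =
  toC (restrictR phi (pword T x l)).
Proof.
rewrite (restrictRE up (word_ae _ _)); congr (toC (restrictR _ _)).
rewrite /pword big_tnth; apply: eq_bigr => i _.
by rewrite -surjective_pairing.
Qed.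

Lemma UP_word l : admissible_seq F m l ->
  msq (restrictR phi (pword T x l) - \prod_(b <- l) restrictR phi (letter T x b))
    < delta ^+ 2.
Proof.
move=> al; have [_ /(_ _ _ _ (adm al)) + _ _] := UPphi.
rewrite wordE (_ : \prod_(i < _) _ = toC (\prod_(b <- l) restrictR phi (letter T x b))).
  by rewrite -toCB norm2_toC sqrt_lt.
rewrite toC_prod big_tnth; apply: eq_bigr => i _.
rewrite (restrictRE up (koopman_ae _ _)).
by rewrite -surjective_pairing.
Qed.

Lemma UP_mean l : admissible_seq F m l ->
  `|meanv (restrictR phi (pword T x l)) - Exp (pword T x l)| < delta.
Proof.
move=> al; have [_ _ + _] := UPphi.
move=> /(_ (word a p (fun i => (tnth (in_tuple l) i).1) (fun i => (tnth (in_tuple l) i).2))).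
move=> /(_ _)/wrap[]; first by do 3 eexists; split; [exact: adm al|].
rewrite wordE zeta_toC (cintegral_ae (word_ae _ _)).
rewrite (_ : \prod_(i < _) _ = pword T x l).
  rewrite -rmorphB; move: (_ - _) => r.
  by rewrite /= expr0n/= addr0 sqrtr_sqr.
rewrite /pword big_tnth; apply: eq_bigr => i _.
by rewrite -surjective_pairing.
Qed.

Lemma UP_shift s n : F s -> (n < m)%N ->
  msq (restrictR phi (T s (x n)) - shiftv (sigma s) (restrictR phi (x n))) < delta ^+ 2.
Proof.
move=> Fs nm; have [_ _ _ /(_ s n Fs nm)] := UPphi.
rewrite (restrictRE up (koopman_ae _ _)) (restrictRE up (p_ae hp n)).
by rewrite perm_shift_toC -toCB norm2_toC sqrt_lt.
Qed.

End OfUP.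

Lemma UP_extendC (F : set G) (m : nat) (delta : R) (psi : bfun_palg mu -> 'I_d -> R) :
  0 < delta -> ustate psi ->
  (forall l, admissible_seq F m l ->
    msq (psi (pword T x l) - \prod_(b <- l) psi (letter T x b)) < delta ^+ 2 /\
    `|meanv (psi (pword T x l)) - Exp (pword T x l)| < delta) ->
  (forall s n, F s -> (n < m)%N ->
    msq (psi (T s (x n)) - shiftv (sigma s) (psi (x n))) < delta ^+ 2) ->
  UP a p F m delta sigma (extendC psi).
Proof.
move=> d0 us wl sh; have up := extendC_up us.
have adm j (s : 'I_j -> G) (n : 'I_j -> nat) : admissible F m s n ->
    admissible_seq F m [seq (s i, n i) | i <- enum 'I_j].
  move=> [jm sF nm]; split; last by move=> _ /mapP[i _ ->]; split; [exact: sF|exact: nm].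
  by rewrite size_map size_enum_ord.
have wordE j (s : 'I_j -> G) (n : 'I_j -> nat) : extendC psi (word a p s n) =
    toC (psi (pword T x [seq (s i, n i) | i <- enum 'I_j])).
  by rewrite (restrictRE up (word_ae s n)) extendCK /pword big_map big_enum.
split=> //.
- move=> j s n /adm /wl[+ _].
  rewrite wordE (_ : \prod_(i < j) _ =
      toC (\prod_(b <- [seq (s i, n i) | i <- enum 'I_j]) psi (letter T x b))).
    by rewrite -toCB norm2_toC sqrt_lt.
  rewrite toC_prod big_map big_enum; apply: eq_bigr => i _.
  by rewrite (restrictRE up (koopman_ae _ _)) extendCK.
- move=> _ [j [s [n [/adm /wl[_ +] ->]]]].
  rewrite wordE zeta_toC (cintegral_ae (word_ae _ _)) /pword big_map big_enum -rmorphB.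
  by move: (_ - _) => r; rewrite /= expr0n/= addr0 sqrtr_sqr.
- move=> s n Fs nm; rewrite (restrictRE up (koopman_ae _ _)) (restrictRE up (p_ae hp n)).
  rewrite extendCK perm_shift_toC -toCB norm2_toC sqrt_lt//.
  exact: sh.
Qed.

Lemma UP_sub (F F' : set G) m m' (delta delta' : R) phi : F' `<=` F -> (m' <= m)%N ->
  delta <= delta' -> UP a p F m delta sigma phi -> UP a p F' m' delta' sigma phi.
Proof.
move=> FF mm dd [up w1 w2 w3].
have adm j (s : 'I_j -> G) (n : 'I_j -> nat) : admissible F' m' s n -> admissible F m s n.
  move=> [/andP[j1 j2] sF nm]; split=> [|i|i]; first by rewrite j1 (leq_trans j2).
    exact: FF.
  exact: leq_trans (nm i) mm.
split=> //.
- by move=> j s n /adm h; apply: lt_le_trans dd; exact: w1.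
- move=> f [j [s [n [/adm h ->]]]]; apply: lt_le_trans dd; apply: w2.
  by exists j, s, n.
- move=> s n Fs nm; apply: lt_le_trans dd; apply: w3; first exact: FF.
  exact: leq_trans nm mm.
Qed.

End RealUP.

Section AsymptoticUP.
Context (G : groupType) (disp : measure_display) (X : measurableType disp)
  (R : realType) (mu : probability X R) (a : pmp_action G mu).
Variables (d : nat -> nat) (sigma : forall i, G -> 'S_(d i)).
Hypotheses (hd : d @ \oo --> \oo) (hsigma : sofic_maps R sigma).
Variable p : nat -> Linfty mu.
Hypothesis hp : forall n, real_unit_ball (p n).

Section Along.
Variables (I : Type) (F : set_system I).
Context {FF : Filter F}.
Variables (idx : I -> nat) (phi : forall i, Linfty mu -> 'I_(d (idx i)) -> R[i]).
Arguments phi : clear implicits.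

Hypothesis hidx : forall i0, \forall i \near F, (i0 <= idx i)%N.

Lemma sofic_along_UP : sofic_along R F (fun i => sigma (idx i)).
Proof.
move=> s t e e0; have [+ _] := hsigma => /(_ s t)/cvgrPdist_le/(_ e e0).
move=> [i0 _ i0P]; apply: filterS (hidx i0) => i /i0P /=.
set A := [pred k | _]; set r := _ / _ => h.
have cA : (#|A| + #|predC A| = d (idx i))%N by rewrite cardC card_ord.
have dA : (#|A| <= d (idx i))%N by have := max_card A; rewrite card_ord.
have -> : #|[pred k | sigma (idx i) (s * t)%g k != sigma (idx i) s (sigma (idx i) t k)]|
    = (d (idx i) - #|A|)%N.
  transitivity #|predC A|; first exact: eq_card.
  by apply: (@addnI #|A|); rewrite cA subnKC.
move: h; rewrite /r; move: #|A| dA => c dA h.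
have [d0|d0] := eqVneq (d (idx i)) 0%N; first by rewrite d0 invr0 mulr0 ltW.
rewrite natrB//.
rewrite mulrBl divff ?pnatr_eq0//.
exact: le_trans (ler_norm _) h.
Qed.

Lemma asym_UP : (forall (E : set G) m (delta : R), finite_set E -> E !=set0 ->
    (0 < m)%N -> 0 < delta ->
    \forall i \near F, UP a p E m delta (sigma (idx i)) (phi i)) ->
  asym (bact a) F (fun i => sigma (idx i)) (rgen p) (fun i => restrictR (phi i)).
Proof.
move=> hUP.
have sqrt_min (e : R) : 0 < e -> exists2 delta, 0 < delta & delta <= e /\ delta ^+ 2 <= e.
  move=> e0; exists (Num.min e 1); first by rewrite lt_min e0 ltr01.
  have m1 : Num.min e 1 <= 1 by rewrite ge_min lexx orbT.
  have me : Num.min e 1 <= e by rewrite ge_min lexx.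
  have m0 : 0 <= Num.min e 1 by rewrite le_min (ltW e0) ler01.
  by split=> //; apply: le_trans me; rewrite expr2 ler_piMr.
have adm (l : seq (G * nat)) : l != [::] -> exists E m,
    [/\ finite_set E, E !=set0, (0 < m)%N & admissible_seq E m l].
  (* This [m] bounds the length and, thanks to the successors, strictly bounds every index in the
     word. *)
  move=> l0; exists [set` map fst l], (size l + \sum_(b <- l) b.2.+1)%N.
  have sl : (0 < size l)%N by rewrite lt0n size_eq0.
  split; [exact: finite_seq| |by rewrite addn_gt0 sl|].
    by case: l l0 sl => // b l _ _; exists b.1; rewrite /= inE eqxx.
  split; first by rewrite sl leq_addr.
  move=> b bl; split; first by apply/mapP; exists b.
  by rewrite (big_rem b)//= addnCA leq_addr.
split.
- have := hUP [set 1%g] 1%N 1 (finite_set1 _) (ex_intro _ 1%g erefl) isT ltr01.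
  by apply: filterS => i [up _ _ _]; exact: restrictR_ustate.
(* Admissible words are nonempty; the empty word is settled by unitality. *)
- move=> l; have [->|/adm[E [m [fE nE m0 lE]]]] := eqVneq l [::].
    apply: aeq_eq.
    have := hUP [set 1%g] 1%N 1 (finite_set1 _) (ex_intro _ 1%g erefl) isT ltr01.
    apply: filterS => i [up _ _ _]; apply/funext => k.
    by rewrite /pword !big_nil (us1 (restrictR_ustate up)).
  move=> e /sqrt_min[delta d0 [_ de]].
  apply: filterS (hUP _ _ _ fE nE m0 d0) => i UPi; apply: le_trans de.
  exact/ltW/(UP_word hp d0 UPi).
- move=> l e e0; have [->|/adm[E [m [fE nE m0 lE]]]] := eqVneq l [::].
    (* The mean of the constant 1 is 1 only when the dimension is positive; in dimension 0 it is
       0. *)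
    have /hd[i0 _ i0P] : nbhs \oo [set n | (0 < n)%N] by exists 1%N.
    have hUP1 := hUP [set 1%g] 1%N e (finite_set1 _) (ex_intro _ 1%g erefl) isT e0.
    apply: filterS2 hUP1 (hidx i0) => i [up _ _ _] /i0P di.
    rewrite /pword big_nil Exp1 /meanv.
    under eq_bigr do rewrite (us1 (restrictR_ustate up)).
    by rewrite sumr_const card_ord mulVf ?subrr ?normr0 ?ltW// pnatr_eq0 -lt0n.
  apply: filterS (hUP _ _ _ fE nE m0 e0) => i UPi.
  exact/ltW/(UP_mean hp UPi).
- move=> s n e /sqrt_min[delta d0 [_ de]].
  have := hUP [set s] n.+1 delta (finite_set1 _) (ex_intro _ s erefl) isT d0.
  apply: filterS => i UPi; apply: le_trans de.
  by apply/ltW/(UP_shift hp d0 UPi).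
Qed.

End Along.
End AsymptoticUP.

(** * The pseudometric and separated sets *)

Section RhoBounds.
Context (G : groupType) (disp : measure_display) (X : measurableType disp)
  (R : realType) (mu : probability X R).
Variable p : nat -> Linfty mu.
Hypothesis hp : forall n, real_unit_ball (p n).
Variable d : nat.
Implicit Types phi psi : Linfty mu -> 'I_d -> R[i].

Lemma norm2_diff phi psi n : unital_positive phi -> unital_positive psi ->
  norm2 (phi (p n) - psi (p n)) =
  Num.sqrt (msq (restrictR phi (rgen p n) - restrictR psi (rgen p n))).
Proof.
by move=> u v; rewrite (restrictRE u (p_ae hp n)) (restrictRE v (p_ae hp n)) -toCB norm2_toC.
Qed.

Lemma rho_term phi psi n (e : R) : unital_positive phi -> unital_positive psi ->
  (rho p phi psi <= e%:E)%E ->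
  msq (restrictR phi (rgen p n) - restrictR psi (rgen p n)) <= (2 ^+ n.+1 * e) ^+ 2.
Proof.
move=> u v; rewrite /rho => re; set s := msq _.
have : 2^-1 ^+ n.+1 * Num.sqrt s <= e.
  rewrite -lee_fin; apply: le_trans re.
  apply: le_trans (nneseries_lim_ge n.+1 _); last first.
    by move=> k _ _; rewrite lee_fin mulr_ge0 ?exprn_ge0 ?invr_ge0// sqrtr_ge0.
  rewrite big_nat_recr//= norm2_diff// leeDr// sume_ge0// => k _.
  by rewrite lee_fin mulr_ge0 ?exprn_ge0 ?invr_ge0// sqrtr_ge0.
rewrite exprVn ler_pdivrMl ?exprn_gt0// => h.
rewrite -[leLHS]sqr_sqrtr ?msq_ge0// lerXn2r ?nnegrE ?sqrtr_ge0//.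
exact: le_trans (sqrtr_ge0 _) h.
Qed.

(** The weights add up to at most 1 over the first [K] terms; beyond them the weights add up to
    [2 ^ (- K)], and two images of an element of the unit ball are at distance at most 2. *)
Lemma rho_le phi psi K (k : R) : unital_positive phi -> unital_positive psi -> 0 <= k ->
  (forall n, (n < K)%N ->
    msq (restrictR phi (rgen p n) - restrictR psi (rgen p n)) <= k ^+ 2) ->
  (rho p phi psi <= (k + 2 * 2^-1 ^+ K)%:E)%E.
Proof.
move=> u v k0 hk; rewrite /rho.
have t0 n : (0 <= (2^-1 ^+ n.+1 * norm2 (phi (p n) - psi (p n)))%:E)%E.
  by rewrite lee_fin mulr_ge0 ?exprn_ge0 ?invr_ge0// sqrtr_ge0.
apply: lime_le; first by apply: is_cvg_nneseries => n _ _; exact: t0.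
apply: nearW => N; rewrite sumEFin lee_fin.
have tk n : (n < K)%N -> norm2 (phi (p n) - psi (p n)) <= k.
  move=> nK; rewrite norm2_diff// -[leRHS]ger0_norm// -sqrtr_sqr.
  by rewrite ler_wsqrtr// hk.
have t2 n : norm2 (phi (p n) - psi (p n)) <= 2.
  rewrite norm2_diff// -[leRHS]ger0_norm// -sqrtr_sqr ler_wsqrtr//.
  apply: (@le_trans _ _ (meanv (fun _ : 'I_d => 2 ^+ 2))).
    apply: msq_le_meanv => t; rewrite !fctE.
    have [x1 x2] := rgen_unitball hp n.
    have := us_bound (restrictR_ustate u) t (M := 1); rewrite cstB1 => /(_ _ x1 x2).
    have := us_bound (restrictR_ustate v) t (M := 1); rewrite cstB1 => /(_ _ x1 x2).
    rewrite !ler_norml => /andP[? ?] /andP[? ?].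
    rewrite -subr_ge0 subr_sqr mulr_ge0//; lra.
  rewrite /meanv sumr_const card_ord.
  have [->|d0] := eqVneq d 0%N; first by rewrite invr0 mul0r sqr_ge0.
  by rewrite -(mulr_natr (2 ^+ 2) d) mulrC -mulrA divff ?mulr1// pnatr_eq0.
have h0 n : 0 < (2^-1 : R) ^+ n by rewrite exprn_gt0// invr_gt0.
(* Exact partial sums of the two geometric majorants; the second bracket is 0 as long as
   [N <= K]. *)
suff : \sum_(0 <= n < N) 2^-1 ^+ n.+1 * norm2 (phi (p n) - psi (p n)) <=
    k * (1 - 2^-1 ^+ N) + 2 * (2^-1 ^+ K - 2^-1 ^+ maxn N K).
  move/le_trans; apply; rewrite lerD//.
    by rewrite ler_piMr// lerBlDr lerDl ltW.
  by rewrite ler_wpM2l// lerBlDr lerDl ltW.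
elim: N => [|N IH].
  by rewrite big_nil max0n !subrr !mulr0 addr0.
rewrite big_nat_recr//=; apply: (le_trans (lerD IH (lexx _))).
have [NK|KN] := ltnP N K.
  rewrite ?(maxn_idPr (ltnW NK)) (maxn_idPr NK) !subrr !mulr0 !addr0.
  have := ler_wpM2l (ltW (h0 N.+1)) (tk N NK).
  rewrite exprS; move: (2^-1 ^+ N) => b; lra.
rewrite ?(maxn_idPl KN) (maxn_idPl (leqW KN)).
have := ler_wpM2l (ltW (h0 N.+1)) (t2 N); have := h0 N.
have := mulr_ge0 k0 (ltW (h0 N)).
rewrite exprS; move: (2^-1 ^+ N) (2^-1 ^+ K) => b c; lra.
Qed.

End RhoBounds.

Section SepNumber.
Context (R : realType).

Lemma sep_number_ge0 (T : Type) (Y : set T) (rho : T -> T -> \bar R) e :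
  (0 <= sep_number Y rho e)%E.
Proof.
apply: ereal_sup_ubound; exists 0%N => //; exists set0; split=> //.
by rewrite II0.
Qed.

(** The images of a separated set are separated, hence distinct because [rhoU u u <= 0 < e'];
    injectivity of [f] on all of [Y] is not asked for. *)
Lemma sep_number_le (T U : Type) (Y : set T) (Z : set U)
    (rhoT : T -> T -> \bar R) (rhoU : U -> U -> \bar R) (e e' : R) (f : T -> U) :
  (forall x, Y x -> Z (f x)) -> 0 < e' ->
  (forall u, Z u -> (rhoU u u <= 0)%E) ->
  (forall x y, Y x -> Y y -> (rhoU (f x) (f y) <= e'%:E)%E -> (rhoT x y <= e%:E)%E) ->
  (sep_number Y rhoT e <= sep_number Z rhoU e')%E.
Proof.
move=> YZ e'0 rho0 fr; apply: ereal_sup_le => _ [n [A [AY An Asep]] <-].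
have sep x y : A x -> A y -> x <> y -> (e'%:E < rhoU (f x) (f y))%E.
  move=> Ax Ay xy; rewrite ltNge; apply/negP => /(fr _ _ (AY _ Ax) (AY _ Ay)).
  by apply/negP; rewrite -ltNge; exact: Asep.
exists n => //; exists (f @` A); split.
- by move=> _ [x Ax <-]; exact/YZ/AY.
- apply: card_eq_trans An; apply: inj_card_eq => x y /set_mem Ax /set_mem Ay fxy.
  apply: contrapT => xy; have := sep x y Ax Ay xy; rewrite fxy.
  apply/negP; rewrite -leNgt; apply: le_trans (rho0 _ (YZ _ (AY _ Ay))) _.
  by rewrite lee_fin ltW.
- by move=> _ _ [x Ax <-] [y Ay <-] xy; apply: sep => // xe; apply: xy; rewrite xe.
Qed.

Lemma limn_esup_near_le (u v : nat -> \bar R) :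
  (\forall n \near \oo, (u n <= v n)%E) -> (limn_esup u <= limn_esup v)%E.
Proof.
move=> uv; apply: le_ereal_inf_tmp => _ [V VF <-].
apply: (@le_trans _ _ (ereal_sup [set u n | n in V `&` [set n | (u n <= v n)%E]])).
  by apply: ereal_inf_lbound; exists (V `&` [set n | (u n <= v n)%E]) => //; exact: filterI.
apply: ge_ereal_sup => _ [n [Vn un] <-]; apply: (le_trans un).
by apply: ereal_sup_ubound; exists n.
Qed.

End SepNumber.

(** * Filters of approximate homomorphisms *)

Section EntropyComparison.
Context (G : groupType) (disp : measure_display) (X : measurableType disp)
  (R : realType) (mu : probability X R) (a : pmp_action G mu).
Variables (d : nat -> nat) (sigma : forall i, G -> 'S_(d i)).
Hypotheses (hd : d @ \oo --> \oo) (hsigma : sofic_maps R sigma).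
Local Notation T := (bact a).
Local Notation maps i := (Linfty mu -> 'I_(d i) -> R[i]).

(** The components are F, m, delta and a lower bound for the index of the sofic approximation. *)
Definition param := (set G * nat * R * nat)%type.
Definition valid_param (c : param) : Prop :=
  [/\ finite_set c.1.1.1, c.1.1.1 !=set0, (0 < c.1.1.2)%N & 0 < c.1.2].

Definition eventualUP (q : nat -> Linfty mu) (c : param) i (phi : maps i) : Prop :=
  (c.2 <= i)%N /\ UP a q c.1.1.1 c.1.1.2 c.1.2 (sigma i) phi.

Definition join_param (c c' : param) : param :=
  (c.1.1.1 `|` c'.1.1.1, maxn c.1.1.2 c'.1.1.2, Num.min c.1.2 c'.1.2, maxn c.2 c'.2).

Lemma join_param_valid c c' : valid_param c -> valid_param c' -> valid_param (join_param c c').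
Proof.
move=> [f1 [s cs] m1 e1] [f2 n2 m2 e2]; split=> /=.
- by rewrite finite_setU.
- by exists s; left.
- by rewrite leq_max m1.
- by rewrite lt_min e1.
Qed.

Lemma join_paramP q c c' i (phi : maps i) : eventualUP q (join_param c c') phi ->
  eventualUP q c phi /\ eventualUP q c' phi.
Proof.
rewrite /eventualUP /= geq_max => -[/andP[i1 i2] UPphi]; split; split=> //.
  by apply: UP_sub UPphi; [exact: subsetUl|exact: leq_maxl|rewrite ge_min lexx].
by apply: UP_sub UPphi; [exact: subsetUr|exact: leq_maxr|rewrite ge_min lexx orbT].
Qed.

Definition UPspace := {i : nat & maps i}.
Definition UPpairs := {i : nat & (maps i * maps i)%type}.

(** A property holds along this filter when one parameter works for all maps at once, the uniformity
    needed for counting. The filter may contain the empty set, so spaces [UP] that become empty need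
    no separate treatment. *)
Definition UPfilter q : set_system UPspace :=
  filter_from valid_param (fun c => [set z | eventualUP q c (projT2 z)]).

Definition UPpair_filter q : set_system UPpairs :=
  filter_from (fun ce : param * R => valid_param ce.1 /\ 0 < ce.2)
   (fun ce => [set z | [/\ eventualUP q ce.1 (projT2 z).1, eventualUP q ce.1 (projT2 z).2
      & (rho q (projT2 z).1 (projT2 z).2 <= ce.2%:E)%E]]).

Let c0 : param := ([set 1%g], 1%N, 1, 0%N).
Let c0_valid : valid_param c0.
Proof. by split=> //=; exists 1%g. Qed.

Lemma UPfilter_filter q : Filter (UPfilter q).
Proof.
apply: filter_from_filter; first by exists c0.
move=> c c' vc vc'; exists (join_param c c'); first exact: join_param_valid.
by move=> z /join_paramP.
Qed.

Lemma UPpair_filter_filter q : Filter (UPpair_filter q).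
Proof.
apply: filter_from_filter; first by exists (c0, 1).
move=> [c e] [c' e'] /= [vc e0] [vc' e'0].
exists (join_param c c', Num.min e e').
  by split; [exact: join_param_valid|rewrite /= lt_min e0].
move=> z /= [/join_paramP[u u'] /join_paramP[v v'] re].
by split; split=> //; apply: (le_trans re); rewrite lee_fin ge_min lexx ?orbT.
Qed.

Section Gen.
Variable q : nat -> Linfty mu.
Hypothesis hq : forall n, real_unit_ball (q n).

Let FF := UPfilter_filter q.
Let FF2 := UPpair_filter_filter q.
#[local] Existing Instance FF.
#[local] Existing Instance FF2.

Lemma UPfilter_idx i0 : \forall z \near UPfilter q, (i0 <= projT1 z)%N.
Proof. by exists ([set 1%g], 1%N, 1, i0) => [|z []//]; case: c0_valid. Qed.

Lemma UPfilter_UP (E : set G) m (delta : R) : finite_set E -> E !=set0 ->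
  (0 < m)%N -> 0 < delta ->
  \forall z \near UPfilter q, UP a q E m delta (sigma (projT1 z)) (projT2 z).
Proof. by move=> *; exists (E, m, delta, 0%N) => [|z []]. Qed.

Lemma UPpair_filter_idx i0 : \forall z \near UPpair_filter q, (i0 <= projT1 z)%N.
Proof.
by exists (([set 1%g], 1%N, 1, i0), 1) => [|z [[]]//]; split=> //; case: c0_valid.
Qed.

Lemma UPpair_filter_UP (E : set G) m (delta : R) : finite_set E -> E !=set0 ->
  (0 < m)%N -> 0 < delta -> \forall z \near UPpair_filter q,
    UP a q E m delta (sigma (projT1 z)) (projT2 z).1 /\
    UP a q E m delta (sigma (projT1 z)) (projT2 z).2.
Proof.
move=> fE nE m0 d0; exists ((E, m, delta, 0%N), 1) => [|z /= [[_ u] [_ v] _]].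
  by split=> /=.
by split.
Qed.

Lemma UPpair_filter_rho (e : R) : 0 < e -> \forall z \near UPpair_filter q,
  (rho q (projT2 z).1 (projT2 z).2 <= e%:E)%E.
Proof. by move=> e0; exists (c0, e) => [|z []]. Qed.

Lemma asym_UPfilter : asym T (UPfilter q) (fun z => sigma (projT1 z)) (rgen q)
  (fun z => restrictR (projT2 z)).
Proof. by apply: asym_UP => //; [exact: UPfilter_idx|exact: UPfilter_UP]. Qed.

Lemma sofic_along_UPfilter : sofic_along R (UPfilter q) (fun z => sigma (projT1 z)).
Proof. by apply: sofic_along_UP => //; exact: UPfilter_idx. Qed.

Lemma UPpair_filter_close (b : bfun_palg mu) : walg T (rgen q) b ->
  aeq (UPpair_filter q) (fun z => restrictR (projT2 z).1 b)
                        (fun z => restrictR (projT2 z).2 b).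
Proof.
move=> wb; apply: (@as_continuity _ _ _ T _ _ _ _ (fun z => sigma (projT1 z)) (rgen q)
  (fun z => restrictR (projT2 z).1) _ (fun z => restrictR (projT2 z).2)) wb.
- apply: asym_UP => //; first exact: UPpair_filter_idx.
  move=> E m delta fE nE m0 d0; apply: filterS (UPpair_filter_UP fE nE m0 d0).
  by move=> z [].
- apply: asym_UP => //; first exact: UPpair_filter_idx.
  move=> E m delta fE nE m0 d0; apply: filterS (UPpair_filter_UP fE nE m0 d0).
  by move=> z [].
- move=> n e e0.
  have r0 : 0 < Num.min e 1 / 2 ^+ n.+1 by rewrite divr_gt0// lt_min e0 ltr01.
  have up := @UPpair_filter_UP [set 1%g] 1%N 1 (finite_set1 _) (ex_intro _ 1%g erefl) isT ltr01.
  apply: filterS2 up (UPpair_filter_rho r0) => z [[u _ _ _] [v _ _ _]] hr.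
  apply: (le_trans (rho_term hq n u v hr)).
  rewrite mulrCA divff ?gt_eqF// mulr1.
  have m1 : Num.min e 1 <= 1 by rewrite ge_min lexx orbT.
  have m0 : 0 <= Num.min e 1 by rewrite le_min (ltW e0) ler01.
  by apply: (@le_trans _ _ (Num.min e 1)); [rewrite expr2 ler_piMr|rewrite ge_min lexx].
Qed.

End Gen.
End EntropyComparison.

Lemma bounded_words (A : eqType) (s : seq A) m : exists W : seq (seq A),
  forall l, (l \in W) <-> (size l <= m)%N /\ {subset l <= s}.
Proof.
elim: m => [|m [W WP]].
  exists [:: [::]] => l; rewrite inE leqn0 size_eq0; split=> [/eqP ->|[]//].
  by split.
exists ([::] :: [seq b :: l | b <- s, l <- W]) => l; rewrite inE; split.
  case/predU1P => [-> //|/allpairsP[[b l'] /= [bs /WP[sl l's] ->]]].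
  by split=> // c; rewrite inE => /predU1P[->//|/l's].
case: l => [//|b l] [sl ls]; apply/orP; right; apply/allpairsP; exists (b, l).
split=> //=; first by apply: ls; rewrite inE eqxx.
by apply/WP; split=> // c cl; apply: ls; rewrite inE cl orbT.
Qed.

(** * Comparison of the two entropies *)

Section Comparison.
Context (G : groupType) (disp : measure_display) (X : measurableType disp)
  (R : realType) (mu : probability X R) (a : pmp_action G mu).
Variables (d : nat -> nat) (sigma : forall i, G -> 'S_(d i)).
Hypotheses (hd : d @ \oo --> \oo) (hsigma : sofic_maps R sigma).
Variables (p q : nat -> Linfty mu).
Hypotheses (hp : forall n, real_unit_ball (p n)) (hq : forall n, real_unit_ball (q n)).
Hypotheses (hpgen : dynamically_generating a p) (hqgen : dynamically_generating a q).
Local Notation T := (bact a).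
Local Notation x := (rgen p).
Local Notation y := (rgen q).
Local Notation B := (bfun_palg mu).

Let FF := UPfilter_filter a sigma p.
#[local] Existing Instance FF.

Definition transferC (H : seq B) i (phi : Linfty mu -> 'I_(d i) -> R[i]) :
  Linfty mu -> 'I_(d i) -> R[i] := extendC (restrictR phi \o cexp H).

(** The result is a list of functions and a tolerance, not a partition, so that several such demands
    can be met by one common [H]. *)
Lemma transferC_UP (E : set G) m (delta : R) : finite_set E -> 0 < delta ->
  exists (L : seq B) (k : R), 0 < k /\
  forall H, pou (walg T x) H -> (forall f, f \in L -> cvar H f <= k) ->
    \forall z \near UPfilter a sigma p,
      UP a q E m delta (sigma (projT1 z)) (transferC H (projT2 z)).
Proof.
move=> /finite_seqP[SE ->] d0.
pose Alph := [seq (s, n) | s <- SE, n <- iota 0 m].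
have AlphP s n : s \in SE -> (n < m)%N -> (s, n) \in Alph.
  by move=> sS nm; apply/allpairsP; exists (s, n); rewrite mem_iota.
have [W WP] := bounded_words Alph m.
pose e1 := delta ^+ 2 / 2; have e10 : 0 < e1 by rewrite divr_gt0// exprn_gt0.
have e1d : e1 < delta ^+ 2.
  by rewrite ltr_pdivrMr// ltr_pMr ?exprn_gt0// ltr1n.
have d20 : 0 < delta / 2 by rewrite divr_gt0.
(* Small enough for [transfer_word] at every length up to [m], and at most [e1 / 16] for
   [transfer_shift]. The halves in [e1] and [delta / 2] turn the weak estimates into the strict ones
   of [UP]. *)
pose k := e1 / 4 ^+ m.+3; have k0 : 0 < k by rewrite divr_gt0// exprn_gt0.
exists ([seq pword T y l | l <- W] ++ [seq letter T y b | b <- Alph] ++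
  [seq y n | n <- iota 0 m]), k.
split=> // H pH Hk.
have Hasym := asym_UPfilter a sigma hd hp.
have Hsof := sofic_along_UPfilter a hsigma p.
have y1 := rgen_unitball hq.
have kletter b : b \in Alph -> cvar H (letter T y b) <= k.
  by move=> bA; apply: Hk; rewrite !mem_cat map_f ?orbT.
have k16 : k <= e1 / 16.
  rewrite ler_wpM2l ?(ltW e10)// lef_pV2 ?posrE ?exprn_gt0//.
  have : (1 : R) <= 4 ^+ m by rewrite exprn_ege1// ler1n.
  by rewrite !exprS; move: (4 ^+ m) => c; lra.
have nw : \forall z \near UPfilter a sigma p, forall l, l \in W ->
    msq (restrictR (projT2 z) (cexp H (pword T y l)) -
         \prod_(b <- l) restrictR (projT2 z) (cexp H (letter T y b))) <= e1 /\
    `|meanv (restrictR (projT2 z) (cexp H (pword T y l))) - Exp (pword T y l)| <= delta / 2.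
  apply: near_seq => l lW; have /WP[sl lA] := lW.
  have h1 : 4 ^+ (size l).+2 * k <= e1.
    rewrite /k mulrC -mulrA ger_pMr// mulrC.
    rewrite ler_pdivrMr ?exprn_gt0// mul1r ler_weXn2l ?ler1n//.
    by rewrite !ltnS leqW.
  have h2 : cvar H (pword T y l) <= k by apply: Hk; rewrite !mem_cat map_f.
  have h3 b : b \in l -> cvar H (letter T y b) <= k by move=> /lA; exact: kletter.
  apply: filterS2 (transfer_word y1 Hasym pH k0 h1 h2 h3) (transfer_mean y Hasym pH l d20).
  by move=> z u v; split.
have ns : \forall z \near UPfilter a sigma p, forall b, b \in Alph ->
    msq (restrictR (projT2 z) (cexp H (letter T y b)) -
      shiftv (sigma (projT1 z) b.1) (restrictR (projT2 z) (cexp H (y b.2)))) <= e1.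
  apply: near_seq => -[s n] bA.
  apply: (transfer_shift Hasym Hsof pH e10).
    exact: le_trans (kletter _ bA) k16.
  apply: le_trans k16; apply: Hk; rewrite !mem_cat map_f ?orbT//.
  by have /allpairsP[[s' n'] /= [_ nm [_ ->]]] := bA.
apply: filterS3 (transfer_state Hasym pH) nw ns => z us uw ush.
apply: UP_extendC => //.
- move=> l [/andP[_ sl] lE].
  have /uw[u v] : l \in W.
    apply/WP; split=> // -[s n] /lE[/= sE nm]; exact: AlphP.
  split; first exact: le_lt_trans u e1d.
  by apply: (le_lt_trans v); rewrite ltr_pdivrMr// ltr_pMr// ltr1n.
- move=> s n sE nm; apply: le_lt_trans e1d.
  exact: (ush (s, n) (AlphP _ _ sE nm)).
Qed.

Lemma walg_gen n : walg T x (x n).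
Proof. by rewrite -(pact1 T (x n)); exact: (walg_letter T x (1%g, n)). Qed.

Lemma transferC_msq (b : nat -> B) (K : nat) (k1 : R) : 0 < k1 ->
  (forall n, Exp ((x n - b n) ^+ 2) <= k1 / 8) ->
  exists (L : seq B) (k : R), 0 < k /\
  forall H, pou (walg T x) H -> (forall f, f \in L -> cvar H f <= k) ->
    \forall z \near UPfilter a sigma p, forall n, n \in iota 0 K ->
      msq (restrictR (projT2 z) (x n) - restrictR (projT2 z) (cexp H (b n))) <= 4 * k1.
Proof.
move=> k10 hb; exists [seq x n | n <- iota 0 K], (k1 / 2); split=> [|H pH Hk].
  by rewrite divr_gt0.
have Hasym := asym_UPfilter a sigma hd hp.
apply: near_seq => n nK.
have h1 : cvar H (x n) < k1.
  by apply: le_lt_trans (Hk _ (map_f _ nK)) _; rewrite ltr_pdivrMr// ltr_pMr// ltr1n.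
have h2 : 4 * Exp ((x n - b n) ^+ 2) < k1 by have := hb n; lra.
apply: filterS2 (transfer_base Hasym pH (walg_gen n) h1) (transfer_close Hasym pH h2).
move=> z u v; rewrite (_ : 4 * k1 = 2 * k1 + 2 * k1); last by ring.
exact: (msq_tri_le u v).
Qed.

Lemma rho_self (i : nat) (u : Linfty mu -> 'I_i -> R[i]) : (rho q u u <= 0)%E.
Proof.
rewrite /rho eseries0// => n _ _; rewrite subrr /norm2 big1 ?mulr0 ?sqrtr0 ?mulr0//.
by move=> k _; rewrite -[_ k]/(0 : R[i]) /= !expr0n/= addr0 sqrtr0 expr0n.
Qed.

(** The scale [e'] precedes [E'], [m'], [delta']: it comes from [UPpair_filter_close] on the
    polynomials [b n] in [q] near [x n], for finitely many [n]. Only then is [H] chosen, and [phi]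
    on [x n] is compared with its transfer on [b n]. *)
Lemma entropy_at_compare (e : R) : 0 < e -> exists2 e' : R, 0 < e' &
  forall E' m' (delta' : R), finite_set E' -> E' !=set0 -> (0 < m')%N -> 0 < delta' ->
  exists E m (delta : R), [/\ finite_set E, E !=set0, (0 < m)%N, 0 < delta &
    (entropy_at a p sigma e E m delta <= entropy_at a q sigma e' E' m' delta')%E].
Proof.
move=> e0.
have [K Ke] : exists K, 2 * 2^-1 ^+ K <= e / 2.
  exists (Num.truncn (4 / e)).+1; rewrite exprVn.
  rewrite ler_pdivrMr ?exprn_gt0// mulrAC ler_pdivlMr// -[2 * 2]natrM mulnn.
  rewrite -ler_pdivrMl// mulrC; apply: (@le_trans _ _ (Num.truncn (4 / e)).+1%:R).
    exact/ltW/Num.Theory.truncnS_gt.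
  by rewrite -natrX ler_nat ltnW// ltn_expl.
(* Two squared triangle inequalities give [2 (4 k1) + 2 (2 k1 + 2 (4 k1)) = 28 k1], below
   [64 k1 = (e / 4)^2]; then [rho] is at most [e / 4 + e / 2]. *)
pose k1 := (e / 4) ^+ 2 / 64.
have k10 : 0 < k1 by rewrite divr_gt0// exprn_gt0// divr_gt0.
have /choice[b bP] n : exists b, walg T y b /\ Exp ((x n - b) ^+ 2) <= k1 / 8.
  have k18 : 0 < k1 / 8 by rewrite divr_gt0.
  have [b wb hb] := goodP (walg_subalgebra T y) (all_good hq hqgen (x n)) k18.
  by exists b.
have FF2 := UPpair_filter_filter a sigma q.
have [[c e'] /= [vc e'0] cP] : \forall z \near UPpair_filter a sigma q,
    forall n, n \in iota 0 K ->
    msq (restrictR (projT2 z).1 (b n) - restrictR (projT2 z).2 (b n)) <= k1.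
  apply: near_seq => n _.
  by apply: (UPpair_filter_close sigma hd hq) k10; case: (bP n).
exists e' => // E' m' delta' fE nE m0 delta0.
(* The transferred maps must lie in the prescribed [UP] and also be good enough homomorphisms for
   [cP] to apply to pairs of them. *)
pose j := join_param c (E', m', delta', 0%N).
have vj : valid_param j by apply: join_param_valid.
have [fj nj mj dj] := vj.
have [L1 [r1 [r10 H1]]] := transferC_UP j.1.1.2 fj dj.
have [L2 [r2 [r20 H2]]] := transferC_msq K k10 (fun n => (bP n).2).
have r0 : 0 < Num.min r1 r2 by rewrite lt_min r10.
have [|H pH HL] := @good_seq _ _ _ (walg_subalgebra T x) (L1 ++ L2) _ r0.
  by move=> f _; exact: (all_good hp hpgen).
have {}H1 := H1 H pH _; have {}H2 := H2 H pH _.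
have [[[[E m] delta] i0] [/= fE0 nE0 m00 delta00] cpP] :
    \forall z \near UPfilter a sigma p,
    UP a q j.1.1.1 j.1.1.2 j.1.2 (sigma (projT1 z)) (transferC H (projT2 z)) /\
    forall n, n \in iota 0 K ->
      msq (restrictR (projT2 z) (x n) - restrictR (projT2 z) (cexp H (b n))) <= 4 * k1.
  apply: filterS2 (H1 _) (H2 _) => // f fL.
    by apply: le_trans (HL f _) _; rewrite ?mem_cat ?fL// ge_min lexx.
  by apply: le_trans (HL f _) _; rewrite ?mem_cat ?fL ?orbT// ge_min lexx orbT.
exists E, m, delta.
split; [exact: fE0|exact: nE0|exact: m00|exact: delta00|].
apply: limn_esup_near_le; exists (maxn i0 j.2); first by [].
move=> i; rewrite /= geq_max => /andP[i0i ji].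
have main phi : UP a p E m delta (sigma i) phi ->
    [/\ eventualUP a sigma q j (transferC H phi : Linfty mu -> 'I_(d i) -> R[i]),
      unital_positive phi & forall n, (n < K)%N ->
      msq (restrictR phi (x n) - restrictR phi (cexp H (b n))) <= 4 * k1].
  move=> UPphi; have [u v] := cpP (existT _ i phi) (conj i0i UPphi).
  split; [by split|by case: UPphi|].
  by move=> n nK; apply: v; rewrite mem_iota.
apply: lee_wpmul2l; first by rewrite lee_fin invr_ge0.
rewrite lee_lne ?in_itv/= ?sep_number_ge0 ?leey//.
apply: (@sep_number_le _ _ _ _ _ _ _ _ _ (transferC H (i := i))).
- by move=> phi /main[/join_paramP[_ [_ UPq]] _ _]; exact: UPq.
- exact: e'0.
- by move=> u _; exact: rho_self.
move=> phi psi /main[/join_paramP[c1 _] up1 m1] /main[/join_paramP[c2 _] up2 m2] rhoq.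
have hb := cP (existT _ i (transferC H phi, transferC H psi)) (And3 c1 c2 rhoq).
have k40 : 0 <= e / 4 by rewrite ltW// divr_gt0.
apply: (le_trans (rho_le (K := K) hp up1 up2 k40 _)); last first.
  by rewrite lee_fin; lra.
move=> n nK.
apply: (le_trans (msq_tri _ (restrictR phi (cexp H (b n))) _)).
have t2 := msq_tri (restrictR phi (cexp H (b n))) (restrictR psi (cexp H (b n)))
  (restrictR psi (x n)).
have := hb n; rewrite mem_iota /= add0n => /(_ nK).
rewrite /transferC !extendCK /= => h3.
have := m2 n nK; rewrite msqBC => h4; have := m1 n nK => h5.
rewrite (_ : (e / 4) ^+ 2 = 64 * k1); last by rewrite /k1; field.
lra.
Qed.

Lemma entropy_le : (entropy a p sigma <= entropy a q sigma)%E.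
Proof.
apply: ge_ereal_sup => _ [e /= e0 <-].
have [e' e'0 cmp] := entropy_at_compare e0.
apply: le_ereal_sup_tmp; eexists; first by exists e'.
apply: le_ereal_inf_tmp => _ [E' [fE' nE'] <-].
apply: le_ereal_inf_tmp => _ [m' /= m'0 <-].
apply: le_ereal_inf_tmp => _ [delta' /= d'0 <-].
have [E [m [delta [fE nE m0 d0 le]]]] := cmp _ _ _ fE' nE' m'0 d'0.
apply: le_trans le; apply: ge_ereal_inf; eexists; first by exists E.
apply: ge_ereal_inf; eexists; first by exists m.
by apply: ge_ereal_inf; eexists; first by exists delta.
Qed.

End Comparison.

Theorem theorem2p6 (R : realType) (G : groupType)
    (hG : countable [set: G]) (hsofic : sofic R G)
    (disp : measure_display) (X : measurableType disp) (mu : probability X R)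
    (hX : standard_borel R X) (a : pmp_action G mu)
    (d : nat -> nat) (sigma : forall i, G -> 'S_(d i))
    (hsigma : sofic_approximation R sigma)
    (p q : nat -> Linfty mu)
    (hp : forall n, real_unit_ball (p n))
    (hq : forall n, real_unit_ball (q n))
    (hpgen : dynamically_generating a p)
    (hqgen : dynamically_generating a q) :
  entropy a q sigma = entropy a p sigma.
Proof.
have [hd hs] := hsigma.
apply: le_anti; apply/andP; split; first exact: (entropy_le hd hs hq hp hqgen hpgen).
exact: (entropy_le hd hs hp hq hpgen hqgen).
Qed.
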